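(* Let $S,I:\mathbb{R}\to\mathbb{R}$ be $2\pi$-periodic Lipschitz functions and suppose there are $\alpha_0\in(0,\pi)$, $p,q\ge1$, $c_1,c_2>0$, $c_3\in(0,1]$, $c_4>0$, $I_*>0$ such that: $S(\theta)\le-c_1(\pi-\theta)^p$ for $\theta\in[\alpha_0,\pi]$ and $S(\theta)\ge c_1(\theta+\pi)^p$ for $\theta\in[-\pi,-\alpha_0]$; $0\le I(\theta)\le c_2(\pi-|\theta|)^q$ for $\theta\in[-\pi,\pi]$; $\min_{|\phi|\le\max\{|\theta|,\alpha_0\}}I(\phi)\ge c_3I(\theta)$ for $\theta\in[-\pi,\pi]$; $S'(\theta)\ge c_4(I_*-I(\theta))$ for all $\theta$; $I'(\theta)S(\theta)\ge0$ for all $\theta$; and $I(\theta)>0$ for all $\theta\in(-\pi,\pi)$. Let $\omega_1,\dots,\omega_N\in\mathbb{R}$, $\|\Omega\|_\infty=\max_i|\omega_i|$, and assume \[ \kappa>\max\left\{\frac{2(2c_2)^{p/q}}{c_1c_3}\cdot\frac{\|\Omega\|_\infty}{I_*^{1+p/q}},\ \frac{2}{c_1c_3(\pi-\alpha_0)^p}\cdot\frac{\|\Omega\|_\infty}{I_*}\right\}. \] Then for Lebesgue almost every initial data $\Theta^0\in\mathbb{R}^N$, the solution of $\dot\theta_i=\omega_i+\frac{\kappa}{N}\sum_{j=1}^NI(\theta_j)S(\theta_i)$, $\theta_i(0)=\theta_i^0$, with $R(t)=\frac1N\sum_jI(\theta_j(t))$, satisfies (a) $\liminf_{t\to\infty}R(t)>\frac{c_3I_*}{2}$;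 (b) $\limsup_{t\to\infty}\theta_i(t)-\liminf_{t\to\infty}\theta_i(t)<2\pi$ for all $i=1,\dots,N$.
   Context: $S'$ and $I'$ denote derivatives (the conditions presuppose differentiability). *)

(* Defs.v *)
From HB Require Import structures.
From mathcomp Require Import all_boot all_order all_algebra.
From mathcomp Require Import all_classical all_reals all_analysis.
Set Implicit Arguments. Unset Strict Implicit. Unset Printing Implicit Defensive.
Import Order.TTheory GRing.Theory Num.Theory.
Import numFieldNormedType.Exports.
Local Open Scope classical_set_scope.
Local Open Scope ring_scope.

Definition lipschitzR (R : realType) (f : R -> R) : Prop :=
  exists L : R, forall x y : R, `|f x - f y| <= L * `|x - y|.

Definition periodic2pi (R : realType) (f : R -> R) : Prop :=
  forall x : R, f (x + 2 * pi) = f x.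

Definition lebesgue_nullN (R : realType) (N : nat) (A : set ('I_N -> R)) : Prop :=
  forall eps : R, 0 < eps ->
    exists a b : nat -> 'I_N -> R,
      (forall k i, a k i <= b k i) /\
      (A `<=` \bigcup_k [set x | forall i, a k i <= x i <= b k i]) /\
      (forall n, \sum_(k < n) \prod_(i < N) (b k i - a k i) <= eps).

Definition supnorm (R : realType) (N : nat) (w : 'I_N -> R) : R :=
  \big[Num.max/0]_(i < N) `|w i|.

Definition order_param (R : realType) (N : nat) (I : R -> R)
    (theta : 'I_N -> R -> R) (t : R) : R :=
  N%:R^-1 * \sum_(j < N) I (theta j t).

Definition is_solution (R : realType) (N : nat) (S I : R -> R)
    (omega : 'I_N -> R) (kappa : R) (theta0 : 'I_N -> R)
    (theta : 'I_N -> R -> R) : Prop :=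
  (forall i, theta i 0 = theta0 i) /\
  (forall i (t : R), 0 <= t ->
     derivable (theta i) t 1 /\
     derive1 (theta i) t =
       omega i + kappa / N%:R * \sum_(j < N) I (theta j t) * S (theta i t)).

Definition liminf_infty (R : realType) (f : R -> R) : \bar R :=
  limf_einf (fun t => (f t)%:E) (pinfty_nbhs R).
Definition limsup_infty (R : realType) (f : R -> R) : \bar R :=
  limf_esup (fun t => (f t)%:E) (pinfty_nbhs R).

(* Main.v *)
(** The vector field F has divergence at least D := N kappa c4 R (I_* - R).  As
    long as R stays below I_* the flow expands volume, so the set E of initial
    data for which R never exceeds I_* - I_*/(4N) is invariant under an expanding
    flow on a torus of finite volume, hence null.  To make this work for a field
    that is only Lipschitz, the flow is replaced by a product G of Euler steps in
    one coordinate at a time.  Averages over the grid with n points per coordinate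
    satisfy [avg ((f \o G) * (1 + h D)) <= avg f] up to O(1/n) + O(h^2): with Psi
    the integral of f between x_i and its image, the mean value theorem bounds the
    effect of one step by an increment of Psi, and these increments cancel when
    the grid is rotated.  Take f = max(0, -ln (dist(., E) + e)), whose drop along
    one step of the flow is O(h) uniformly in e.  Then avg (f D) stays bounded
    while f is of order -ln e near E; letting e tend to 0 kills the volume of
    {D > 0} in E.

    For other initial data R(t0) > I_* - I_*/(4N) at some time t0.  The oscillators
    with I(theta_i(t0)) >= I_*/2 are then trapped: while they all stay in
    |theta| <= max(|theta_i(t0)|, alpha0), R exceeds c3 I_*/2, and with this R
    the field points inwards at the endpoints of these arcs.  Every other
    oscillator either enters a trapping arc or stays between two of them. *)
Require Import Defs.
From HB Require Import structures.
From mathcomp Require Import all_boot all_order all_algebra.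
From mathcomp Require Import all_classical all_reals all_analysis.
From mathcomp Require Import ring lra.
Import Order.TTheory GRing.Theory Num.Theory.
Import numFieldNormedType.Exports.
Local Open Scope classical_set_scope.
Local Open Scope ring_scope.
Set Implicit Arguments. Unset Strict Implicit. Unset Printing Implicit Defensive.

(** * Lipschitz continuity, mean values and antiderivatives *)

Lemma lipschitz_continuous (R : realType) (f : R -> R) (L : R) :
  (forall x y, `|f x - f y| <= L * `|x - y|) -> continuous f.
Proof.
move=> fL x; apply/cvgrPdist_lt => e e0.
have L0 : 0 < `|L| + 1 by rewrite ltr_wpDl.
near=> y; apply: le_lt_trans (fL x y) _.
apply: (@le_lt_trans _ _ ((`|L| + 1) * `|x - y|)).
  by rewrite ler_wpM2r// (le_trans (ler_norm L))// lerDl.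
rewrite -ltr_pdivlMl//; near: y; apply: cvgr_dist_lt => //.
by rewrite mulr_gt0// invr_gt0.
Unshelve. all: by end_near. Qed.

Lemma derive_ge_increment (R : realType) (f df : R -> R) (a b c : R) :
  a <= b -> (forall x, a <= x <= b -> is_derive x 1 f (df x)) ->
  (forall x, a <= x <= b -> c <= df x) -> c * (b - a) <= f b - f a.
Proof.
move=> ab fd dfc; have [x|x|x xab ->] := MVT_segment (f := f) (df := df) ab.
- by rewrite in_itv/= => /andP[ax xb]; apply: fd; rewrite !ltW.
- apply: derivable_within_continuous => y yab.
  by have [] := fd y; rewrite in_itv/= in yab.
- by rewrite ler_wpM2r ?subr_ge0// dfc// -in_itv.
Qed.

(** An integral from [a] is a primitive only to the right of [a], so callers put [a] to the left of
    every point at which they evaluate. *)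
Lemma exists_antiderivative (R : realType) (f : R -> R) (a : R) :
  continuous f -> exists F : R -> R, forall x, a < x -> is_derive x 1 F (f x).
Proof.
move=> fc; exists (fun x => (\int[lebesgue_measure]_(t in `[a, x]) f t)%R) => x ax.
have [||dF <-] := @continuous_FTC1_closed R f a x (x + 1) _ _ ax (fc x).
- by rewrite ltrDl.
- apply: continuous_compact_integrable; first exact: segment_compact.
  exact: continuous_subspaceT.
- by rewrite derive1E; exact: derivableP.
Qed.

(** * Functions on the torus *)

Section Torus.
Variables (R : realType) (N : nat).
Implicit Types (x y : 'I_N -> R) (f g F D : ('I_N -> R) -> R) (i : 'I_N).

Definition upd x i (u : R) : 'I_N -> R := fun j => if j == i then u else x j.

Definition dist1 x y : R := \sum_j `|x j - y j|.

Definition lattice_shift (z : 'I_N -> int) x : 'I_N -> R :=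
  fun j => x j + 2 * pi * (z j)%:~R.

Definition lipschitz1 f := exists2 L : R,
  0 <= L & forall x y, `|f x - f y| <= L * dist1 x y.

Definition bounded1 f := exists2 B : R, 0 <= B & forall x, `|f x| <= B.

(** Lipschitz functions on the torus, seen as lattice-periodic functions on R^N. The bound is
    carried along because the Lipschitz constant of a product depends on it. *)
Definition regular f :=
  [/\ lipschitz1 f, bounded1 f & forall z x, f (lattice_shift z x) = f x].

Lemma upd_id x i : upd x i (x i) = x.
Proof. by apply/funext => j; rewrite /upd; case: eqP => // ->. Qed.

Lemma upd_same x i u : upd x i u i = u.
Proof. by rewrite /upd eqxx. Qed.

Lemma upd_upd x i u v : upd (upd x i u) i v = upd x i v.
Proof. by apply/funext => j; rewrite /upd; case: eqP. Qed.

Lemma dist1_ge0 x y : 0 <= dist1 x y.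
Proof. by apply: sumr_ge0. Qed.

Lemma dist1C x y : dist1 x y = dist1 y x.
Proof. by apply: eq_bigr => j _; rewrite distrC. Qed.

Lemma dist1_triangle x y z : dist1 x z <= dist1 x y + dist1 y z.
Proof.
by rewrite /dist1 -big_split/=; apply: ler_sum => j _; exact: ler_distD.
Qed.

Lemma ler_dist1 x y i : `|x i - y i| <= dist1 x y.
Proof. by rewrite /dist1 (bigD1 i)//= lerDl sumr_ge0. Qed.

Lemma dist1_upd x y i u v :
  dist1 (upd x i u) (upd y i v) <= dist1 x y + `|u - v|.
Proof.
rewrite /dist1 (bigD1 i)//= [in leRHS](bigD1 i)//= !upd_same.
rewrite (eq_bigr (fun j => `|x j - y j|)); last first.
  by move=> j /negPf ji; rewrite /upd ji.
by rewrite addrC lerD2r lerDr.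
Qed.

Lemma dist1_upd1 x i u v : dist1 (upd x i u) (upd x i v) = `|u - v|.
Proof.
rewrite /dist1 (bigD1 i)//= !upd_same big1 ?addr0// => j /negPf ji.
by rewrite /upd ji subrr normr0.
Qed.

Lemma dist1_le_bound x y c : (forall j, `|x j - y j| <= c) ->
  dist1 x y <= N%:R * c.
Proof.
move=> xyc; apply: (@le_trans _ _ (\sum_(j < N) c)); first exact: ler_sum.
by rewrite sumr_const card_ord mulr_natl.
Qed.

Lemma dist1_lattice_shift z x y :
  dist1 (lattice_shift z x) (lattice_shift z y) = dist1 x y.
Proof. by apply: eq_bigr => j _; rewrite /lattice_shift; congr `|_|; ring. Qed.

Lemma lattice_shiftK z x : lattice_shift (fun j => - z j) (lattice_shift z x) = x.
Proof. by apply/funext => j; rewrite /lattice_shift intrN; ring. Qed.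

Lemma regular_cst c : regular (fun=> c).
Proof.
split=> //; first by exists 0 => // x y; rewrite subrr normr0 mul0r.
by exists `|c|.
Qed.

Lemma regularD f g : regular f -> regular g -> regular (fun x => f x + g x).
Proof.
move=> [[L L0 fL] [B B0 fB] fP] [[L' L'0 gL] [B' B'0 gB] gP]; split.
- exists (L + L') => [|x y]; first by rewrite addr_ge0.
  rewrite opprD addrACA (le_trans (ler_normD _ _))// mulrDl.
  by rewrite lerD.
- exists (B + B') => [|x]; first by rewrite addr_ge0.
  by rewrite (le_trans (ler_normD _ _))// lerD.
- by move=> z x; rewrite fP gP.
Qed.

Lemma regularM f g : regular f -> regular g -> regular (fun x => f x * g x).
Proof.
move=> [[L L0 fL] [B B0 fB] fP] [[L' L'0 gL] [B' B'0 gB] gP]; split.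
- exists (L * B' + B * L') => [|x y]; first by rewrite addr_ge0 ?mulr_ge0.
  have -> : f x * g x - f y * g y = (f x - f y) * g x + f y * (g x - g y).
    by ring.
  rewrite (le_trans (ler_normD _ _))// !normrM mulrDl lerD//.
    by rewrite mulrAC ler_pM.
  by rewrite -mulrA ler_pM.
- exists (B * B') => [|x]; first by rewrite mulr_ge0.
  by rewrite normrM ler_pM.
- by move=> z x; rewrite fP gP.
Qed.

Lemma regular_sum (I : Type) (s : seq I) (f : I -> ('I_N -> R) -> R) :
  (forall k, regular (f k)) -> regular (fun x => \sum_(k <- s) f k x).
Proof.
move=> fr; elim: s => [|k s IH].
  by under eq_fun do rewrite big_nil; exact: regular_cst.
by under eq_fun do rewrite big_cons; exact: regularD.
Qed.

(** Only one coordinate moves, so the effect on averages is a change of variables in dimension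
    one. *)
Definition euler_step F h i x := upd x i (x i + h * F x).

Lemma euler_step_lattice_shift F h i z x : regular F ->
  euler_step F h i (lattice_shift z x) = lattice_shift z (euler_step F h i x).
Proof.
move=> [_ _ FP]; apply/funext => j; rewrite /euler_step FP /lattice_shift /upd.
by case: eqP => // ->; ring.
Qed.

Lemma regular_euler_step f F h i : regular f -> regular F ->
  regular (fun x => f (euler_step F h i x)).
Proof.
move=> [[L L0 fL] [B B0 fB] fP] Fr; have [[L' L'0 FL] _ _] := Fr; split.
- exists (L * (2 + `|h| * L')) => [|x y].
    by rewrite mulr_ge0// addr_ge0// mulr_ge0.
  rewrite (le_trans (fL _ _))// -mulrA ler_wpM2l// (le_trans (dist1_upd _ _ _ _ _))//.
  have -> : x i + h * F x - (y i + h * F y) = (x i - y i) + h * (F x - F y).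
    by ring.
  have := ler_normD (x i - y i) (h * (F x - F y)); rewrite normrM.
  have := ler_dist1 x y i; have := FL x y => FLxy.
  have : `|h| * `|F x - F y| <= `|h| * (L' * dist1 x y) by rewrite ler_wpM2l.
  lra.
- by exists B.
- by move=> z x; rewrite euler_step_lattice_shift.
Qed.

End Torus.

(** * Change of variables along one Euler step *)

Lemma derive0_cst (R : realType) (f : R -> R) (a : R) :
  (forall x, a < x -> is_derive x 1 f 0) ->
  forall x y, a < x -> a < y -> f x = f y.
Proof.
move=> fd x y; wlog xy : x y / x <= y => [H ax ay|ax ay].
  by case/orP: (le_total x y) => xy; [exact: H|apply/esym; exact: H].
have [z||c _ /eqP] := MVT_segment (f := f) (df := fun=> 0) xy.
- by rewrite in_itv/= => /andP[xz _]; apply: fd; exact: lt_trans xz.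
- apply: derivable_within_continuous => z; rewrite in_itv/= => /andP[xz _].
  by have [] := fd z (lt_le_trans ax xz).
- by rewrite mul0r subr_eq0 => /eqP.
Qed.

Section Grid.
Variables (R : realType) (N : nat).
Implicit Types (x y : 'I_N -> R) (f F D : ('I_N -> R) -> R) (i : 'I_N).

Lemma upd_period x i u :
  upd x i (u + 2 * pi) = lattice_shift (fun j => (j == i)%:R) (upd x i u).
Proof.
apply/funext => j; rewrite /upd /lattice_shift; case: eqP => _.
  by rewrite mulr1.
by rewrite mulr0 addr0.
Qed.

Lemma regular_continuous1 f x i : regular f ->
  continuous (fun u => f (upd x i u)).
Proof.
move=> [[L _ fL] _ _]; apply: (@lipschitz_continuous _ _ L) => u v.
by rewrite -(dist1_upd1 x i u v).
Qed.

(* [Psi] is the antiderivative of [f] in the [i]-th variable, taken between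
   [x i] and its image under the Euler step. *)
Lemma euler_step_potential f F D i (h : R) :
  regular f -> regular F -> regular D -> (forall x, 0 <= f x) -> 0 <= h ->
  (forall x, `|h * F x| <= 1) ->
  (forall x u, derivable (fun v => F (upd x i v)) u 1 /\
     D (upd x i u) <= derive1 (fun v => F (upd x i v)) u) ->
  exists (Psi : ('I_N -> R) -> R) (C : R),
    (forall x d, 0 <= x i -> 0 <= d ->
      (f (euler_step F h i x) * (1 + h * D x) - f x) * d - C * d ^+ 2 <=
        Psi (upd x i (x i + d)) - Psi x) /\
    (forall x, 0 <= x i -> Psi (upd x i (x i + 2 * pi)) = Psi x).
Proof.
move=> fr Fr Dr f0 h0 hF Fd.
pose w x := f (euler_step F h i x) * (1 + h * D x) + -1 * f x.
(* The Lipschitz constant of [w] becomes the [C] of the quadratic error. *)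
have [[C C0 wC] _ _] : regular w.
  apply: regularD; last by apply: regularM => //; exact: regular_cst.
  apply: regularM; first exact: regular_euler_step.
  by apply: regularD; [|apply: regularM => //]; exact: regular_cst.
(* With [x i] nonnegative and [|h * F x|] at most 1, every point met below is at least -1, hence to
   the right of -2. *)
have /choice[Phi PhiP] : forall y, exists P : R -> R,
    forall u : R, -2 < u -> is_derive u 1 P (f (upd y i u)).
  by move=> y; apply: exists_antiderivative; exact: regular_continuous1.
pose Psi x := Phi (upd x i 0) (x i + h * F x) - Phi (upd x i 0) (x i).
exists Psi, C; split => [x d xi d0|x xi]; last first.
  rewrite /Psi upd_upd upd_same upd_period upd_id.
  have [_ _ ->] := Fr.
  set y := upd x i 0.
  (* [Q] is constant because [f] has period 2 pi in the [i]-th variable, so both ends of the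
     integral may be moved by a period. *)
  pose Q u := Phi y (u + 2 * pi) - Phi y u.
  have Qd (u : R) : -2 < u -> is_derive u 1 Q 0.
    move=> u2.
    have -> : 0 = f (upd y i (u + 2 * pi)) * 1 - f (upd y i u).
      by rewrite upd_period; case: fr => _ _ ->; ring.
    apply: is_deriveB; last exact: PhiP.
    apply: (@is_derive1_comp _ (Phi y) (fun v => v + 2 * pi)).
      apply: PhiP; have := pi_ge0 R; lra.
    exact: is_derive_shift.
  have := hF x; rewrite ler_norml => /andP[hF1 _].
  have : Q (x i + h * F x) = Q (x i) by apply: (derive0_cst Qd); lra.
  rewrite /Q (_ : x i + h * F x + 2 * pi = x i + 2 * pi + h * F x); first by lra.
  by ring.
set y := upd x i 0.
have yE u : upd x i u = upd y i u by rewrite upd_upd.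
pose W u := Phi y (u + h * F (upd x i u)) - Phi y u.
have -> : Psi (upd x i (x i + d)) - Psi x = W (x i + d) - W (x i).
  by rewrite /Psi /W upd_upd upd_same upd_id.
pose dW u := f (upd x i (u + h * F (upd x i u))) *
  (1 + h * derive1 (fun v => F (upd x i v)) u) - f (upd x i u).
have Wd (u : R) : x i <= u <= x i + d -> is_derive u 1 W (dW u).
  move=> /andP[xu _]; have [dF _] := Fd x u.
  apply: is_deriveB; last first.
    by rewrite yE; apply: PhiP; lra.
  apply: (@is_derive1_comp _ (Phi y) (fun v => v + h * F (upd x i v))).
    rewrite (yE (u + _)); apply: PhiP.
    have := hF (upd x i u); rewrite ler_norml => /andP[hF1 _]; lra.
  apply: is_deriveD.
  rewrite derive1E.
  apply: (@is_deriveZ _ _ _ (fun v => F (upd x i v)) h u 1).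
  exact: derivableP.
(* [dW] is at least [w] at the moved point, since [f] and [h] are nonnegative and [D] bounds the
   derivative from below; going back to [x] costs at most [C * d]. *)
have dWge u : x i <= u <= x i + d -> w x - C * d <= dW u.
  move=> /andP[xu ud]; apply: (@le_trans _ _ (w (upd x i u))).
      have := wC x (upd x i u).
    have -> : dist1 x (upd x i u) = u - x i.
      by rewrite -[X in dist1 X](upd_id x i) dist1_upd1 distrC ger0_norm ?subr_ge0.
    rewrite ler_norml => /andP[_ +].
    have : C * (u - x i) <= C * d by rewrite ler_wpM2l// lerBlDl.
    lra.
  have [_ DF] := Fd x u.
  rewrite /w /dW /euler_step upd_same upd_upd mulN1r lerD2r.
  by rewrite ler_wpM2l// lerD2l ler_wpM2l.
have xd : x i <= x i + d by rewrite lerDl.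
have := derive_ge_increment xd Wd dWge.
rewrite /w; nra.
Qed.

End Grid.

(** * Averages over grids *)

Section GridAverage.
Variables (R : realType) (N : nat).
Implicit Types (x y : 'I_N -> R) (f g F D : ('I_N -> R) -> R) (i : 'I_N).

Definition grid n (k : {ffun 'I_N -> 'I_n.+1}) : 'I_N -> R :=
  fun j => 2 * pi / n.+1%:R * (k j)%:R.

Definition grid_avg n f : R :=
  (\sum_(k : {ffun 'I_N -> 'I_n.+1}) f (grid k)) / (n.+1 ^ N)%:R.

Lemma grid_avg_le n f g : (forall x, f x <= g x) -> grid_avg n f <= grid_avg n g.
Proof.
by move=> fg; rewrite /grid_avg ler_wpM2r ?invr_ge0//; exact: ler_sum.
Qed.

Lemma grid_avgD n f g :
  grid_avg n (fun x => f x + g x) = grid_avg n f + grid_avg n g.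
Proof. by rewrite /grid_avg big_split/= mulrDl. Qed.

Lemma grid_avgZ n c f : grid_avg n (fun x => c * f x) = c * grid_avg n f.
Proof. by rewrite /grid_avg -mulr_sumr mulrA. Qed.

Lemma grid_avg_cst n c : grid_avg n (fun=> c) = c.
Proof.
rewrite /grid_avg sumr_const card_ffun !card_ord -[c *+ _]mulr_natr mulfK//.
Qed.

Definition rotate n i (k : {ffun 'I_N -> 'I_n.+1}) : {ffun 'I_N -> 'I_n.+1} :=
  [ffun j => if j == i then ordS (k j) else k j].

Lemma rotate_inj n i : injective (@rotate n i).
Proof.
move=> k l /ffunP kl; apply/ffunP => j; move: (kl j); rewrite !ffunE.
by case: eqP => // _; exact: ordS_inj.
Qed.

(** The last index wraps around to 0 and leaves an extra period, which [Psi] does not see. *)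
Lemma upd_grid_rotate n i (k : {ffun 'I_N -> 'I_n.+1}) :
  let y := upd (grid k) i (grid k i + 2 * pi / n.+1%:R) in
  y = grid (rotate i k) \/
  y = upd (grid (rotate i k)) i (grid (rotate i k) i + 2 * pi).
Proof.
have n0 : n.+1%:R != 0 :> R by [].
have [kn|kn] := eqVneq (k i) ord_max; [right|left].
  apply/funext => j; rewrite /upd; case: eqP => [_|/eqP/negPf ji].
    rewrite /grid ffunE eqxx/= kn/= modnn mulr0 add0r -[n.+1%:R]natr1.
    by field; rewrite natr1.
  by rewrite /grid ffunE ji.
apply/funext => j; rewrite /upd; case: eqP => [->|/eqP/negPf ji].
  rewrite /grid ffunE eqxx/= modn_small.
    by rewrite -[(k i).+1%:R]natr1; ring.
  by rewrite ltnS ltn_neqAle -ltnS ltn_ord andbT.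
by rewrite /grid ffunE ji.
Qed.

(** Sum the potential inequality over the grid with [d] the mesh width. The increments of [Psi]
    cancel because rotation permutes the grid, and the quadratic error, divided by [d], leaves a
    multiple of the mesh width. *)
Lemma grid_avg_euler_step f F D i (h : R) :
  regular f -> regular F -> regular D -> (forall x, 0 <= f x) -> 0 <= h ->
  (forall x, `|h * F x| <= 1) ->
  (forall x u, derivable (fun v => F (upd x i v)) u 1 /\
     D (upd x i u) <= derive1 (fun v => F (upd x i v)) u) ->
  exists C : R, forall n,
    grid_avg n (fun x => f (euler_step F h i x) * (1 + h * D x)) <=
    grid_avg n f + C / n.+1%:R.
Proof.
move=> fr Fr Dr f0 h0 hF Fd.
have [Psi [C [PsiC PsiP]]] := euler_step_potential fr Fr Dr f0 h0 hF Fd.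
exists (C * (2 * pi)) => n; pose d : R := 2 * pi / n.+1%:R.
have d0 : 0 < d by rewrite divr_gt0// mulr_gt0// pi_gt0.
have g0 k : 0 <= @grid n k i by rewrite mulr_ge0// ltW.
have -> : C * (2 * pi) / n.+1%:R = C * d by rewrite /d !mulrA.
rewrite -(grid_avg_cst n (C * d)) -grid_avgD.
rewrite /grid_avg ler_wpM2r ?invr_ge0//.
rewrite -(ler_pM2r d0) !mulr_suml.
(* Increments of [Psi] of total zero are added so that the inequality can be checked point by
   point. *)
have -> : \sum_k (f (@grid n k) + C * d) * d =
    \sum_k ((f (@grid n k) + C * d) * d +
             (Psi (grid (rotate i k)) - Psi (grid k))).
  rewrite [RHS]big_split/= sumrB.
  by rewrite [X in _ + (X - _)](_ : _ = \sum_k Psi (@grid n k)) ?subrr ?addr0//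
    [RHS](reindex_inj (@rotate_inj n i)).
apply: ler_sum => k _.
have := PsiC (@grid n k) d (g0 k) (ltW d0).
have -> : Psi (upd (grid k) i (grid k i + d)) = Psi (grid (rotate i k)).
  by have [->//|->] := upd_grid_rotate i k; exact: PsiP.
nra.
Qed.

End GridAverage.

(** * Compositions of Euler steps *)

Lemma norm_sum_le_size (R : realType) (I : Type) (s : seq I) (a : I -> R) (c : R) :
  (forall k, `|a k| <= c) -> `|\sum_(k <- s) a k| <= (size s)%:R * c.
Proof.
move=> ac; elim: s => [|k s IH]; first by rewrite big_nil normr0 mul0r.
by rewrite big_cons/= -natr1 mulrDl mul1r addrC (le_trans (ler_normD _ _))// lerD.
Qed.

Section Composition.
Variables (R : realType) (N : nat) (F D : 'I_N -> ('I_N -> R) -> R).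
Implicit Types (x y : 'I_N -> R) (f : ('I_N -> R) -> R) (i : 'I_N).

Fixpoint euler_seq (h : R) (s : seq 'I_N) x : 'I_N -> R :=
  if s is i :: s' then euler_seq h s' (euler_step (F i) h i x) else x.

(** Product of the lower bounds [1 + h * D i] for the Jacobians of the successive steps, each taken
    at the point where its step starts. *)
Fixpoint weight_seq (h : R) (s : seq 'I_N) x : R :=
  if s is i :: s' then
    weight_seq h s' (euler_step (F i) h i x) * (1 + h * D i x)
  else 1.

Hypotheses (Fr : forall i, regular (F i)) (Dr : forall i, regular (D i)).
Hypothesis FD : forall i x u, derivable (fun v => F i (upd x i v)) u 1 /\
  D i (upd x i u) <= derive1 (fun v => F i (upd x i v)) u.

Lemma weight_seq_ge0 h s x : (forall i x, `|h * D i x| <= 1) ->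
  0 <= weight_seq h s x.
Proof.
move=> hD; elim: s x => [//|i s IH] x /=; rewrite mulr_ge0//.
by have := hD i x; rewrite ler_norml => /andP[]; lra.
Qed.

(** Induction on the list: [f] composed with the remaining steps, times their weight, is again
    regular and nonnegative, so it serves as test function for the first step. *)
Lemma grid_avg_euler_seq f h s : regular f -> (forall x, 0 <= f x) -> 0 <= h ->
  (forall i x, `|h * F i x| <= 1) -> (forall i x, `|h * D i x| <= 1) ->
  regular (fun x => f (euler_seq h s x) * weight_seq h s x) /\
  exists C : R, forall n,
    grid_avg n (fun x => f (euler_seq h s x) * weight_seq h s x) <=
    grid_avg n f + C / n.+1%:R.
Proof.
move=> fr f0 h0 hF hD; elim: s => [|i s [IHr [C IH]]] /=.
  have -> : (fun x => f x * 1) = f by apply/funext => x; rewrite mulr1.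
  by split=> //; exists 0 => n; rewrite mul0r addr0.
set T := fun x => f (euler_seq h s x) * weight_seq h s x in IHr IH.
have T0 x : 0 <= T x by rewrite mulr_ge0// weight_seq_ge0.
have -> : (fun x => f (euler_seq h s (euler_step (F i) h i x)) *
    (weight_seq h s (euler_step (F i) h i x) * (1 + h * D i x))) =
    (fun x => T (euler_step (F i) h i x) * (1 + h * D i x)).
  by apply/funext => x; rewrite mulrA.
split.
  apply: regularM; first exact: regular_euler_step.
  by apply: regularD; [|apply: regularM => //]; exact: regular_cst.
have [C' C'P] := grid_avg_euler_step IHr (Fr i) (Dr i) T0 h0 (hF i) (@FD i).
exists (C + C') => n; rewrite (le_trans (C'P n))// mulrDl addrA.
by rewrite lerD2r.
Qed.

Variable K : R.
Hypotheses (K0 : 0 <= K)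
  (FK : forall i x, `|F i x| <= K) (DK : forall i x, `|D i x| <= K)
  (FL : forall i x y, `|F i x - F i y| <= K * dist1 x y)
  (DL : forall i x y, `|D i x - D i y| <= K * dist1 x y).

Lemma dist1_euler_step i h x : 0 <= h ->
  dist1 (euler_step (F i) h i x) x <= h * K.
Proof.
move=> h0; rewrite -[X in dist1 _ X](upd_id x i) dist1_upd1 addrAC subrr add0r.
by rewrite normrM ger0_norm// ler_wpM2l.
Qed.

(** Each step moves by [O(h)] and the field is Lipschitz, so evaluating it at intermediate points
    costs [O(h ^+ 2)] in all. The induction carries multiplicities; for an enumeration of the
    coordinates they are all 1. *)
Lemma euler_seq_approx s : exists2 C, 0 <= C & forall h, 0 <= h -> forall x j,
  `|euler_seq h s x j - x j - h * (count_mem j s)%:R * F j x| <= C * h ^+ 2.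
Proof.
elim: s => [|i s [C C0 IH]].
  by exists 0 => // h _ x j /=; rewrite subrr mulr0 mul0r subrr normr0 mul0r.
exists (C + (size s)%:R * K ^+ 2) => [|h h0 x j /=].
  by rewrite addr_ge0// mulr_ge0// sqr_ge0.
set y := euler_step (F i) h i x; pose c : R := (count_mem j s)%:R.
have -> : euler_seq h s y j - x j - h * ((i == j) + count_mem j s)%:R * F j x =
    (euler_seq h s y j - y j - h * c * F j y) + h * c * (F j y - F j x).
  have -> : y j = x j + h * (i == j)%:R * F j x.
    rewrite /y /euler_step /upd eq_sym; case: eqP => [->|_].
      by rewrite mulr1.
    by rewrite mulr0 mul0r addr0.
  by rewrite natrD -/c; ring.
rewrite (le_trans (ler_normD _ _))// mulrDl lerD ?IH//.
rewrite normrM (ger0_norm (x := h * c)) ?mulr_ge0//.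
have -> : (size s)%:R * K ^+ 2 * h ^+ 2 = h * (size s)%:R * (K * (h * K)).
  by ring.
apply: ler_pM => //; first by rewrite mulr_ge0.
  by rewrite ler_wpM2l// ler_nat count_size.
by rewrite (le_trans (FL _ _ _))// ler_wpM2l// dist1_euler_step.
Qed.

(** Expand the product to first order; moving each [D i] back to the initial point costs
    [h * O(h)]. *)
Lemma weight_seq_approx s : exists2 C, 0 <= C & forall h, 0 <= h <= 1 ->
  forall x, `|weight_seq h s x - 1 - h * \sum_(i <- s) D i x| <= C * h ^+ 2.
Proof.
elim: s => [|i s [C C0 IH]].
  by exists 0 => // h _ x /=; rewrite big_nil subrr mulr0 subrr normr0 mul0r.
exists (C * (1 + K) + 2 * (size s)%:R * K ^+ 2) => [|h /andP[h0 h1] x /=].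
  by rewrite addr_ge0// !mulr_ge0// ?sqr_ge0// addr_ge0.
set y := euler_step (F i) h i x; rewrite big_cons.
set A := fun z => \sum_(k <- s) D k z; rewrite -/(A x).
have AK z : `|A z| <= (size s)%:R * K.
  exact: norm_sum_le_size.
have AL : `|A y - A x| <= (size s)%:R * (K * (h * K)).
  rewrite /A -sumrB; apply: norm_sum_le_size => k.
  by rewrite (le_trans (DL _ _ _))// ler_wpM2l// dist1_euler_step.
have -> : weight_seq h s y * (1 + h * D i x) - 1 - h * (D i x + A x) =
    (weight_seq h s y - 1 - h * A y) * (1 + h * D i x) + h * (A y - A x)
    + h ^+ 2 * (A y * D i x) by ring.
have eD : `|1 + h * D i x| <= 1 + K.
  rewrite (le_trans (ler_normD _ _))// normr1 lerD2l normrM ger0_norm//.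
  by rewrite -[leRHS]mul1r ler_pM.
rewrite (le_trans (ler_normD _ _))//.
have -> : (C * (1 + K) + 2 * (size s)%:R * K ^+ 2) * h ^+ 2 =
  C * h ^+ 2 * (1 + K) + h * ((size s)%:R * (K * (h * K))) +
  h ^+ 2 * ((size s)%:R * K * K) by ring.
apply: lerD.
  rewrite (le_trans (ler_normD _ _))// lerD// normrM.
    by rewrite ler_pM// IH// h0.
  by rewrite (ger0_norm h0) ler_wpM2l.
rewrite normrM normrX (ger0_norm h0) ler_wpM2l ?sqr_ge0//.
by rewrite normrM ler_pM.
Qed.

End Composition.

(** * Null sets *)

Section NullSets.
Variables (R : realType) (N : nat).
Implicit Types (A : set ('I_N -> R)) (x y : 'I_N -> R).

Lemma sum_uniq_le (T : eqType) (s t : seq T) (v : T -> R) :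
  (forall k, 0 <= v k) -> uniq s -> uniq t -> {subset s <= t} ->
  \sum_(k <- s) v k <= \sum_(k <- t) v k.
Proof.
move=> v0 us ut st.
have sE : perm_eq s [seq k <- t | k \in s].
  apply: uniq_perm => //; first exact: filter_uniq.
  by move=> k; rewrite mem_filter; case: (boolP (k \in s)) => //= /st.
rewrite (perm_big _ sE) big_filter big_mkcond/=; apply: ler_sum => k _.
by case: ifP.
Qed.

Definition boxvol (a b : 'I_N -> R) : R := \prod_i (b i - a i).

Lemma boxvol_ge0 a b : (forall i, a i <= b i) -> 0 <= boxvol a b.
Proof. by move=> ab; apply: prodr_ge0 => i _; rewrite subr_ge0. Qed.

Lemma boxvol_degenerate a : (0 < N)%N -> boxvol a a = 0.
Proof. by move=> N0; rewrite /boxvol (bigD1 (Ordinal N0))//= subrr mul0r. Qed.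

Lemma lebesgue_nullN_subset A B : A `<=` B ->
  lebesgue_nullN B -> lebesgue_nullN A.
Proof.
move=> AB Bn e /Bn[a [b [ab [Bab sab]]]]; exists a, b; split=> //; split=> //.
exact: subset_trans Bab.
Qed.

(** Boxes may be indexed by any countable type, since [pickle] numbers them and only finite partial
    sums need a bound. *)
Lemma lebesgue_nullN_countable_cover A : (0 < N)%N ->
  (forall e : R, 0 < e -> exists (J : countType) (a b : J -> 'I_N -> R),
    [/\ forall j i, a j i <= b j i,
      forall x, A x -> exists j, forall i, a j i <= x i <= b j i &
      forall s, uniq s -> \sum_(j <- s) boxvol (a j) (b j) <= e]) ->
  lebesgue_nullN A.
Proof.
move=> N0 H e /H[J [a [b [ab Aab sab]]]].
(* Numbers that code no index get the degenerate box at the origin, of volume 0 since [N] is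
   positive. *)
pose ext (c : J -> 'I_N -> R) k := oapp c (fun=> 0) (pickle_inv k).
exists (ext a), (ext b); split=> [k i|].
  by rewrite /ext; case: pickle_inv => [j|]/=.
split=> [x /Aab[j xj]|n].
  by exists (pickle j) => // i; rewrite /ext pickleK_inv; exact: xj.
have /sab : uniq (pmap (@pickle_inv J) (iota 0 n)).
  by apply: (pmap_uniq (@pickle_invK J)); exact: iota_uniq.
apply: le_trans.
rewrite -(big_mkord xpredT (fun k => boxvol (ext a k) (ext b k))).
rewrite /index_iota subn0 le_eqVlt; apply/orP; left; apply/eqP.
elim: (iota 0 n) => [|k s IH]; first by rewrite !big_nil.
rewrite big_cons IH /= /ext; case: pickle_inv => [j|]/=.
  by rewrite big_cons.
by rewrite boxvol_degenerate// add0r.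
Qed.

Lemma lebesgue_nullN_finite_cover A : (0 < N)%N ->
  (forall e : R, 0 < e -> exists (J : finType) (a b : J -> 'I_N -> R),
    [/\ forall j i, a j i <= b j i,
      forall x, A x -> exists j, forall i, a j i <= x i <= b j i &
      \sum_j boxvol (a j) (b j) <= e]) ->
  lebesgue_nullN A.
Proof.
move=> N0 H; apply: lebesgue_nullN_countable_cover => // e /H[J [a [b [ab Aab sab]]]].
exists J, a, b; split=> // s us; apply: le_trans sab.
apply: sum_uniq_le => //; first by move=> j; exact: boxvol_ge0.
- exact: index_enum_uniq.
- by move=> j _; exact: mem_index_enum.
Qed.

Lemma lebesgue_nullN_set1 x : (0 < N)%N -> lebesgue_nullN [set x].
Proof.
move=> N0; apply: lebesgue_nullN_finite_cover => // e e0.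
exists unit, (fun=> x), (fun=> x); split=> [//|_ ->|].
  by exists tt => i; rewrite lexx.
by rewrite big1 ?ltW// => j _; exact: boxvol_degenerate.
Qed.

Lemma lebesgue_nullN_lattice_shift z A : lebesgue_nullN A ->
  lebesgue_nullN [set x | A (lattice_shift z x)].
Proof.
move=> An e /An[a [b [ab [Aab sab]]]].
pose t (c : nat -> 'I_N -> R) k := lattice_shift (fun j => - z j) (c k).
exists (t a), (t b); split=> [k i|]; first by rewrite /t lerD2r.
split=> [x /Aab[k _ xk]|n].
  exists k => // i; have := xk i; rewrite /t /lattice_shift intrN; lra.
apply: le_trans (sab n); apply: ler_sum => k _.
rewrite le_eqVlt; apply/orP; left; apply/eqP/eq_bigr => i _.
by rewrite /t /lattice_shift; ring.
Qed.

Lemma sum_half_powers_le1 n : \sum_(k < n) 2^-1 ^+ k.+1 <= 1 :> R.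
Proof.
have -> : \sum_(k < n) 2^-1 ^+ k.+1 = 1 - 2^-1 ^+ n :> R.
  elim: n => [|n IH]; first by rewrite big_ord0 expr0 subrr.
  by rewrite big_ord_recr/= IH exprS; lra.
by rewrite gerBl exprn_ge0// invr_ge0.
Qed.

(** The usual splitting of [e] into [e / 2 ^ (k + 1)], with [k] the code of the index of the set. *)
Lemma lebesgue_nullN_bigcup (I : countType) (A : I -> set ('I_N -> R)) :
  (0 < N)%N -> (forall i, lebesgue_nullN (A i)) ->
  lebesgue_nullN (\bigcup_i A i).
Proof.
move=> N0 An; apply: lebesgue_nullN_countable_cover => // e e0.
have w0 (i : I) : 0 < e * 2^-1 ^+ (pickle i).+1.
  by rewrite mulr_gt0// exprn_gt0// invr_gt0.
have /choice[a /choice[b abP]] := fun i => An i _ (w0 i).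
exists (I * nat)%type, (fun p => a p.1 p.2), (fun p => b p.1 p.2).
have ab p i : a p.1 p.2 i <= b p.1 p.2 i by have [+ _] := abP p.1; exact.
split=> // [x [i _ Aix]|s us].
  have [_ [Aab _]] := abP i; have [k _ xk] := Aab _ Aix.
  by exists (i, k).
pose v p := boxvol (a p.1 p.2) (b p.1 p.2).
have v0 p : 0 <= v p by exact: boxvol_ge0.
(* A finite list of pairs lies in a product of its first components with an initial segment of the
   naturals; sums over the latter are bounded set by set. *)
pose t := undup (map fst s); pose K := (\max_(p <- s) p.2).+1.
have tu : uniq t by exact: undup_uniq.
apply: (@le_trans _ _ (\sum_(p <- [seq (i, k) | i <- t, k <- iota 0 K]) v p)).
  apply: sum_uniq_le => //.
    by apply: allpairs_uniq => //; [exact: iota_uniq|move=> [? ?] [? ?]].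
  move=> [i k] ps; apply/allpairsP; exists (i, k); split=> //.
    by rewrite mem_undup; apply/mapP; exists (i, k).
  by rewrite mem_iota add0n ltnS; exact: (leq_bigmax_seq (i, k)).
rewrite big_allpairs.
apply: (@le_trans _ _ (\sum_(i <- t) e * 2^-1 ^+ (pickle i).+1)).
  apply: ler_sum => i _; have [_ [_ /(_ K)]] := abP i.
  by rewrite -(big_mkord xpredT (fun k => v (i, k))) /index_iota subn0.
rewrite -mulr_sumr ger_pMr//.
pose M := (\max_(i <- t) pickle i).+1.
apply: le_trans (sum_half_powers_le1 M).
rewrite -(big_map pickle xpredT (fun k => 2^-1 ^+ k.+1)).
rewrite -(big_mkord xpredT (fun k => 2^-1 ^+ k.+1)) /index_iota subn0.
apply: sum_uniq_le.
- by move=> k; rewrite exprn_ge0// invr_ge0.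
- by rewrite map_inj_uniq//; exact: (pcan_inj pickleK).
- exact: iota_uniq.
move=> _ /mapP[i it ->]; rewrite mem_iota/= add0n ltnS.
exact: (leq_bigmax_seq i).
Qed.

(** A Chebyshev inequality: a cell that meets [A] has [u] at least 1 at its corner, so such cells
    have total volume at most [(2 * pi) ^+ N] times the average of [u]. *)
Lemma lebesgue_nullN_grid_avg A : (0 < N)%N ->
  (forall y, A y -> forall j, 0 <= y j < 2 * pi) ->
  (forall e, 0 < e -> exists n (u : ('I_N -> R) -> R),
    [/\ forall x, 0 <= u x, grid_avg n u <= e &
      forall x y, A y -> (forall j, `|x j - y j| <= 2 * pi / n.+1%:R) ->
        1 <= u x]) ->
  lebesgue_nullN A.
Proof.
move=> N0 Acube H; apply: lebesgue_nullN_finite_cover => // e e0.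
have p0 : 0 < 2 * pi :> R by rewrite mulr_gt0// pi_gt0.
have pN0 : 0 < (2 * pi) ^+ N :> R by rewrite exprn_gt0.
have [n [u [u0 ue uA]]] := H _ (divr_gt0 e0 pN0).
set d := 2 * pi / n.+1%:R in uA.
have d0 : 0 < d by rewrite divr_gt0.
pose a (k : {ffun 'I_N -> 'I_n.+1}) : 'I_N -> R := grid R k.
pose cell (k : {ffun 'I_N -> 'I_n.+1}) x := forall i, a k i <= x i <= a k i + d.
pose meets (k : {ffun 'I_N -> 'I_n.+1}) := `[< exists2 y, A y & cell k y >].
(* Cells that miss [A] are collapsed to a point, so that they add no volume. *)
pose b (k : {ffun 'I_N -> 'I_n.+1}) i := if meets k then a k i + d else a k i.
exists {ffun 'I_N -> 'I_n.+1}, a, b; split=> [k i|y Ay|].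
- by rewrite /b; case: ifP => _ //; rewrite lerDl ltW.
- have yj j : (Num.truncn (y j / d) < n.+1)%N.
    have /andP[y0 y1] := Acube _ Ay j.
    rewrite -(ltr_nat R) (@le_lt_trans _ _ (y j / d))//.
      by rewrite truncn_le divr_ge0// ltW.
    by rewrite ltr_pdivrMr// /d mulrC divfK.
  exists [ffun j => Ordinal (yj j)].
  have cy : cell [ffun j => Ordinal (yj j)] y.
    move=> i; rewrite /a /grid -/d ffunE/=.
    have /andP[y0 y1] := Acube _ Ay i.
    have /andP[] : (Num.truncn (y i / d))%:R <= y i / d < (Num.truncn (y i / d)).+1%:R.
      by apply: truncn_itv; rewrite divr_ge0// ltW.
    rewrite ler_pdivlMr// ltr_pdivrMr// -natr1; lra.
  have mk : meets [ffun j => Ordinal (yj j)] by apply/asboolP; exists y.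
  by move=> i; rewrite /b mk; exact: cy.
apply: (@le_trans _ _ (\sum_k d ^+ N * u (a k))).
  apply: ler_sum => k _; rewrite /b; case: (boolP (meets k)) => [mk|_].
    have [y Ay cy] := asboolW mk.
    rewrite /boxvol (eq_bigr (fun=> d)); last by move=> i _; rewrite addrAC subrr add0r.
    rewrite prodr_const card_ord; apply: ler_peMr; first by rewrite exprn_ge0// ltW.
    apply: (uA _ _ Ay) => j; have := cy j => cyj.
    by rewrite ler_norml; lra.
  by rewrite boxvol_degenerate// mulr_ge0// exprn_ge0// ltW.
rewrite -mulr_sumr; move: ue; rewrite ler_pdivlMr// => ue; apply: le_trans ue.
by rewrite /d expr_div_n -natrX /grid_avg mulrC mulrA mulrAC.
Qed.

End NullSets.

(** * A truncated logarithm *)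

Section LogCutoff.
Variables (R : realType) (e : R).
Hypothesis e01 : 0 < e < 1.

Definition log_cutoff (t : R) : R := Num.max 0 (- ln (t + e)).

Lemma log_cutoff_ge0 t : 0 <= log_cutoff t.
Proof. by rewrite /log_cutoff le_max lexx. Qed.

Lemma ln_add_le (s t : R) : 0 < t -> 0 < t + s -> ln (t + s) <= ln t + s / t.
Proof.
move=> t0 ts; have -> : t + s = t * (1 + s / t) by field; rewrite gt_eqF.
have st : 0 < 1 + s / t.
  by rewrite -(pmulr_rgt0 _ t0) mulrDr mulr1 mulrCA divff ?mulr1// gt_eqF.
by rewrite lnM ?posrE// lerD2l le_ln1Dx//; lra.
Qed.

(** [ln (t + e + c)] exceeds [ln (t + e)] by at most [c / (t + e)]. Hence a displacement [c]
    proportional to [t] costs a bounded amount, whatever [e] is. *)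
Lemma log_cutoff_drop s t c : 0 <= s -> 0 <= t -> 0 <= c -> s <= t + c ->
  log_cutoff t - c / (t + e) <= log_cutoff s.
Proof.
move=> s0 t0 c0 stc; case/andP: e01 => e0 _.
have te : 0 < t + e by lra.
have cte : 0 <= c / (t + e) by rewrite divr_ge0// ltW.
have H : ln (s + e) <= ln (t + e) + c / (t + e).
  apply: (@le_trans _ _ (ln (t + e + c))); last by apply: ln_add_le; lra.
  by rewrite ler_ln ?posrE; lra.
rewrite /log_cutoff; have [h|h] := leP 0 (- ln (t + e)).
  by rewrite le_max; apply/orP; right; lra.
by rewrite sub0r le_max; apply/orP; left; rewrite oppr_le0.
Qed.

Lemma log_cutoff_lipschitz s t : 0 <= s -> 0 <= t ->
  `|log_cutoff s - log_cutoff t| <= e^-1 * `|s - t|.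
Proof.
move=> s0 t0; case/andP: e01 => e0 _.
have H s' t' : 0 <= s' -> 0 <= t' ->
    log_cutoff t' - e^-1 * `|s' - t'| <= log_cutoff s'.
  move=> s'0 t'0; have st : s' <= t' + `|s' - t'|.
    by rewrite -lerBlDl ler_norm.
  apply: le_trans (log_cutoff_drop s'0 t'0 _ st) => //.
  rewrite lerD2l lerN2 mulrC ler_wpM2r//.
  by rewrite lef_pV2 ?posrE; lra.
have := H _ _ s0 t0; have := H _ _ t0 s0; rewrite distrC.
by rewrite ler_norml; lra.
Qed.

Lemma log_cutoff_le t : 0 <= t -> log_cutoff t <= - ln e.
Proof.
move=> t0; case/andP: e01 => e0 e1; rewrite /log_cutoff ge_max.
by rewrite oppr_ge0 ln_le0 ?lerN2 ?ler_ln ?posrE; lra.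
Qed.

Lemma log_cutoff_near0 t : 0 <= t <= e -> - ln e - 1 <= log_cutoff t.
Proof.
case/andP: e01 => e0 e1 /andP[t0 te].
have := @log_cutoff_drop t 0 e t0 (lexx _) (ltW e0); rewrite add0r => /(_ te).
rewrite divff ?gt_eqF//; apply: le_trans.
by rewrite lerD2r /log_cutoff add0r le_max lexx orbT.
Qed.

(** The bound is uniform in [e]. It controls the region where the divergence is negative, because
    there its size is at most a multiple of the distance [t] to the invariant set. *)
Lemma log_cutoff_mul t : 0 <= t -> t * log_cutoff t <= 1.
Proof.
move=> t0; case/andP: e01 => e0 e1; rewrite /log_cutoff.
have te : 0 < t + e by lra.
have [h|h] := leP 0 (- ln (t + e)); last by rewrite mulr0.
have lt1 : - ln (t + e) <= (t + e)^-1.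
  have := @ln_add_le (1 - (t + e)) (t + e) te.
  rewrite addrCA subrr addr0 ln1 mulrBl divff ?gt_eqF// mul1r => /(_ ltr01).
  lra.
apply: (@le_trans _ _ (t * (t + e)^-1)); first by rewrite ler_wpM2l.
by rewrite ler_pdivrMr// mul1r lerDl ltW.
Qed.

End LogCutoff.

(** * Distance to a set *)

Section DistanceToSet.
Variables (R : realType) (N : nat) (E : set ('I_N -> R)).
Hypothesis E0 : E !=set0.
Implicit Types x y : 'I_N -> R.

Definition dist_set x : R := inf [set dist1 x y | y in E].

Let inf_dist x : has_inf [set dist1 x y | y in E].
Proof.
split; first by have [y Ey] := E0; exists (dist1 x y), y.
by exists 0 => _ [y _ <-]; exact: dist1_ge0.
Qed.

Lemma dist_set_le x y : E y -> dist_set x <= dist1 x y.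
Proof. by move=> Ey; apply: ge_inf; [case: (inf_dist x)|exists y]. Qed.

Lemma dist_set_ge0 x : 0 <= dist_set x.
Proof.
apply: lb_le_inf; first by case: (inf_dist x).
by move=> _ [y _ <-]; exact: dist1_ge0.
Qed.

Lemma dist_set_adherent x c : 0 < c -> exists2 y, E y & dist1 x y < dist_set x + c.
Proof. by move=> /inf_adherent /(_ (inf_dist x))[_ [y Ey <-]]; exists y. Qed.

Lemma dist_set_lipschitz x y : `|dist_set x - dist_set y| <= dist1 x y.
Proof.
have H u v : dist_set u <= dist_set v + dist1 u v.
  apply/ler_addgt0Pr => c c0; have [w Ew wc] := dist_set_adherent v c0.
  have := dist1_triangle u v w; have := dist_set_le u Ew; lra.
have := H x y; have := H y x; rewrite dist1C ler_norml; lra.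
Qed.

Lemma dist_set_lattice_shift z x : (forall z y, E y -> E (lattice_shift z y)) ->
  dist_set (lattice_shift z x) = dist_set x.
Proof.
move=> EP; have H z' u : dist_set (lattice_shift z' u) <= dist_set u.
  apply/ler_addgt0Pr => c c0; have [w Ew wc] := dist_set_adherent u c0.
  apply: le_trans (dist_set_le _ (EP z' _ Ew)) _.
  by rewrite dist1_lattice_shift ltW.
apply/eqP; rewrite eq_le H/=.
by rewrite -{1}(lattice_shiftK z x) H.
Qed.

Lemma regular_log_cutoff_dist e : 0 < e < 1 ->
  (forall z y, E y -> E (lattice_shift z y)) ->
  regular (fun x => log_cutoff e (dist_set x)).
Proof.
move=> e01 EP; have /andP[e0 _] := e01; split.
- exists e^-1 => [|x y]; first by rewrite invr_ge0 ltW.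
  rewrite (le_trans (log_cutoff_lipschitz _ _ _)) ?dist_set_ge0//.
  by rewrite ler_wpM2l ?invr_ge0 ?(ltW e0)// dist_set_lipschitz.
- exists `|ln e| => // x; rewrite ger0_norm ?log_cutoff_ge0//.
  rewrite (le_trans (log_cutoff_le e01 (dist_set_ge0 x)))//.
  by rewrite -normrN ler_norm.
- by move=> z x; rewrite dist_set_lattice_shift.
Qed.

End DistanceToSet.

(** * Invariant sets of an expanding flow *)

Section ExpandingSets.
Variables (R : realType) (N : nat).
Implicit Types (x y : 'I_N -> R) (i j : 'I_N).

Lemma regular_common_bound (F : 'I_N -> ('I_N -> R) -> R) :
  (forall i, regular (F i)) -> exists2 K, 0 <= K &
  (forall i x, `|F i x| <= K) /\
  (forall i x y, `|F i x - F i y| <= K * dist1 x y).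
Proof.
move=> Fr.
have /choice[L LP] : forall i, exists L : R, 0 <= L /\
    forall x y, `|F i x - F i y| <= L * dist1 x y.
  by move=> i; have [[L L0 FL] _ _] := Fr i; exists L.
have /choice[B BP] : forall i, exists B : R, 0 <= B /\ forall x, `|F i x| <= B.
  by move=> i; have [_ [B B0 FB] _] := Fr i; exists B.
have LB0 i : 0 <= L i + B i by rewrite addr_ge0 ?(LP i).1 ?(BP i).1.
have K i : L i + B i <= \sum_k (L k + B k).
  by rewrite (bigD1 i)//= lerDl sumr_ge0.
exists (\sum_k (L k + B k)); first exact: sumr_ge0.
split=> [i x|i x y].
  have := (BP i).2 x; have := (LP i).1; have := K i; lra.
rewrite (le_trans ((LP i).2 x y))// ler_wpM2r ?dist1_ge0//.
by rewrite (le_trans _ (K i))// lerDl (BP i).1.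
Qed.

Variables (F D : 'I_N -> ('I_N -> R) -> R) (E : set ('I_N -> R)).
Hypotheses (Fr : forall i, regular (F i)) (Dr : forall i, regular (D i)).
Hypothesis FD : forall i x u, derivable (fun v => F i (upd x i v)) u 1 /\
  D i (upd x i u) <= derive1 (fun v => F i (upd x i v)) u.
Hypothesis EP : forall z y, E y -> E (lattice_shift z y).
(** Invariance of [E] under the flow, expressed without a flow: from each [y] in [E] some point of
    [E] is approximated to second order by the Euler step of length [h]. *)
Hypothesis EF : exists2 C : R, 0 <= C & forall h, 0 <= h <= 1 -> forall y, E y ->
  exists2 y', E y' & forall j, `|y' j - y j - h * F j y| <= C * h ^+ 2.

Let G h x := euler_seq F h (index_enum 'I_N) x.
Let W h x := weight_seq F D h (index_enum 'I_N) x.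

(** Compare [G h x] with the point [y'] of [E] reached from a nearly closest point [y]. Both follow
    Euler steps up to [O(h ^+ 2)], and the Lipschitz field separates them by a factor [1 + O(h)]
    only. *)
Lemma dist_set_euler_seq : E !=set0 -> exists2 K, 0 <= K & exists2 C, 0 <= C &
  forall h x, 0 <= h <= 1 ->
  dist_set E (G h x) <= (1 + h * K) * dist_set E x + C * h ^+ 2.
Proof.
move=> E0; have [K K0 [FK FL]] := regular_common_bound Fr.
have [C1 C10 GC] := @euler_seq_approx _ _ F K K0 FK FL (index_enum 'I_N).
have [C2 C20 EC] := EF.
exists (N%:R * K); first by rewrite mulr_ge0.
exists (N%:R * (C1 + C2)); first by rewrite mulr_ge0// addr_ge0.
move=> h x h01; have /andP[h0 h1] := h01.
have a0 : 0 < 1 + h * (N%:R * K) by rewrite ltr_pwDl// !mulr_ge0.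
apply/ler_addgt0Pr => e e0.
have [y Ey xy] := dist_set_adherent E0 x (divr_gt0 e0 a0).
have [y' Ey' yy'] := EC h h01 y Ey.
apply: le_trans (dist_set_le E0 _ Ey') _.
have Gy' j : `|G h x j - y' j| <=
    `|x j - y j| + (h * (K * dist1 x y) + (C1 + C2) * h ^+ 2).
  have -> : G h x j - y' j = (x j - y j) +
    ((G h x j - x j - h * (count_mem j (index_enum 'I_N))%:R * F j x)
     - (y' j - y j - h * F j y) + h * (F j x - F j y)).
    rewrite count_uniq_mem ?index_enum_uniq// mem_index_enum/=; ring.
  rewrite (le_trans (ler_normD _ _))// lerD2l.
  rewrite (le_trans (ler_normD _ _))// addrC lerD//.
    by rewrite normrM ger0_norm// ler_wpM2l.
  by rewrite (le_trans (ler_normB _ _))// mulrDl lerD// GC.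
apply: (@le_trans _ _ ((1 + h * (N%:R * K)) * dist1 x y +
    N%:R * (C1 + C2) * h ^+ 2)).
  apply: (@le_trans _ _ (\sum_j (`|x j - y j| +
      (h * (K * dist1 x y) + (C1 + C2) * h ^+ 2)))); first exact: ler_sum.
  rewrite big_split/= sumr_const card_ord -mulr_natl -/(dist1 x y).
  by rewrite le_eqVlt; apply/orP; left; apply/eqP; ring.
rewrite addrAC lerD2r.
apply: (@le_trans _ _ ((1 + h * (N%:R * K)) *
    (dist_set E x + e / (1 + h * (N%:R * K))))).
  by rewrite ler_wpM2l ?(ltW a0)// ltW.
by rewrite mulrDr lerD2l mulrC divfK// gt_eqF.
Qed.

(* [Q] does not depend on [e], although the weight tends to [+oo] on [E] as
   [e] tends to [0]. *)
Lemma grid_avg_log_cutoff_divergence : E !=set0 -> exists2 Q : R, 0 <= Q &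
  forall e, 0 < e < 1 -> exists n0, forall n, (n0 <= n)%N ->
    grid_avg n (fun x => log_cutoff e (dist_set E x) * \sum_i D i x) <= Q.
Proof.
move=> E0; have [K1 K10 [C1 C10 GK]] := dist_set_euler_seq E0.
have [KF KF0 [FKb FL]] := regular_common_bound Fr.
have [KD KD0 [DKb DL]] := regular_common_bound Dr.
pose K : R := KF + KD; have K0 : 0 <= K by rewrite addr_ge0.
have FK i x : `|F i x| <= K by rewrite (le_trans (FKb i x))// lerDl.
have DK i x : `|D i x| <= K by rewrite (le_trans (DKb i x))// lerDr.
have DLK i x y : `|D i x - D i y| <= K * dist1 x y.
  by rewrite (le_trans (DL i x y))// ler_wpM2r ?dist1_ge0// lerDr.
have [C2 C20 WC] := weight_seq_approx K0 FK DK DLK (index_enum 'I_N).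
exists (2 * (K1 + 1) + 2) => [|e e01].
  by rewrite addr_ge0// mulr_ge0// addr_ge0.
have /andP[e0 e1] := e01.
pose f x := log_cutoff e (dist_set E x).
have fr : regular f by exact: regular_log_cutoff_dist.
have f0 x : 0 <= f x by exact: log_cutoff_ge0.
have l0 : 0 <= - ln e by rewrite oppr_ge0 ln_le0// ltW.
pose S x := \sum_i D i x.
have SK x : `|S x| <= (size (index_enum 'I_N))%:R * K.
  by apply: norm_sum_le_size => k; exact: DK.
set nK : R := (size _)%:R * K in SK.
have nK0 : 0 <= nK by rewrite mulr_ge0.
(* Each summand of [M] caps one error term of the step [h = 1 / M]. This [h] depends on [e], but the
   final inequality is divided by [h], so [Q] does not. *)
pose M : R := 1 + K + C1 / e + (nK + C2) + C2 * (- ln e).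
have C1e : 0 <= C1 / e by rewrite divr_ge0// ltW.
have C2l : 0 <= C2 * (- ln e) by rewrite mulr_ge0.
have M0 : 0 < M by rewrite /M; lra.
pose h : R := M^-1; have h0 : 0 < h by rewrite invr_gt0.
have hM : h * M = 1 by rewrite mulVf// gt_eqF.
have hsmall a : 0 <= a -> a <= M -> h * a <= 1.
  by move=> a0 aM; rewrite -hM ler_pM2l.
have h1 : h <= 1 by rewrite -[h]mulr1; apply: hsmall => //; rewrite /M; lra.
have h01 : 0 <= h <= 1 by rewrite ltW.
have hK : h * K <= 1 by apply: hsmall => //; rewrite /M; lra.
have hC1 : h * (C1 / e) <= 1 by apply: hsmall => //; rewrite /M; lra.
have hC2 : h * (nK + C2) <= 1 by apply: hsmall; rewrite /M; lra.
have hl : h * (C2 * (- ln e)) <= 1 by apply: hsmall => //; rewrite /M; lra.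
have hn (a : R) : `|a| <= K -> `|h * a| <= 1.
  move=> aK; rewrite normrM (ger0_norm (ltW h0)); apply: le_trans hK.
  by rewrite ler_wpM2l// ltW.
have [_ [C3 C3P]] := grid_avg_euler_seq Fr Dr FD (index_enum 'I_N) fr f0 (ltW h0)
  (fun i x => hn _ (FK i x)) (fun i x => hn _ (DK i x)).
(* One step lowers [f] by at most [h * (K1 + 1)]; the weight, at most 2, doubles this loss, and the
   second-order error of the weight adds at most [h]. *)
have Tf x : f x + h * (f x * S x) - h * (2 * (K1 + 1) + 1) <= f (G h x) * W h x.
  have W0 : 0 <= W h x by apply: weight_seq_ge0 => i z; exact: hn (DK i z).
  have /ler_normlP[W1 W2] := WC h h01 x; rewrite -/(W h x) -/(S x) in W1 W2.
  have /ler_normlP[S1 S2] := SK x.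
  have d0 := dist_set_ge0 E0 x.
  have fG : f x - h * (K1 + 1) <= f (G h x).
    have := GK h x h01; set d := dist_set E x => Gd.
    have c0 : 0 <= h * K1 * d + C1 * h ^+ 2.
      by rewrite addr_ge0// ?mulr_ge0 ?sqr_ge0// ltW.
    have := @log_cutoff_drop _ e e01 (dist_set E (G h x)) d _
      (dist_set_ge0 E0 _) d0 c0.
    rewrite addrA -{1}[d]mul1r -mulrDl => /(_ Gd); apply: le_trans.
    rewrite lerD2l lerN2 ler_pdivrMr; last by lra.
    have C1h : C1 * h ^+ 2 <= h * e.
      have -> : C1 * h ^+ 2 = h * (h * (C1 / e)) * e by field; rewrite gt_eqF.
      by rewrite ler_wpM2r ?(ltW e0)// ler_piMr// ltW.
    have hd : 0 <= h * d by rewrite mulr_ge0// ltW.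
    have he : 0 <= h * K1 * e by rewrite !mulr_ge0// ltW.
    have -> : h * (K1 + 1) * (d + e) = h * K1 * d + h * e + h * d + h * K1 * e.
      by ring.
    lra.
  have W2' : W h x <= 2.
    have hS : h * S x <= h * nK by rewrite ler_pM2l.
    have : C2 * h ^+ 2 <= h * C2 by rewrite mulrC expr2 -mulrA ler_pM2l// ler_piMl.
    rewrite mulrDr in hC2; lra.
  apply: (@le_trans _ _ ((f x - h * (K1 + 1)) * W h x)); last exact: ler_wpM2r.
  have fW : f x * (1 + h * S x - C2 * h ^+ 2) <= f x * W h x.
    by rewrite ler_wpM2l//; lra.
  have aW : h * (K1 + 1) * W h x <= h * (K1 + 1) * 2.
    by rewrite ler_wpM2l// mulr_ge0 ?(ltW h0)// addr_ge0.
  have fC : f x * (C2 * h ^+ 2) <= h.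
    have -> : f x * (C2 * h ^+ 2) = h * (h * (C2 * f x)) by ring.
    rewrite ler_piMr ?(ltW h0)//; apply: le_trans hl.
    by rewrite ler_wpM2l ?(ltW h0)// ler_wpM2l// log_cutoff_le// dist_set_ge0.
  lra.
(* From here on the grid error [C3 / n.+1] is at most [h], which accounts for the last unit in
   [Q]. *)
exists (Num.truncn (C3 / h)) => n n0.
have := grid_avg_le n Tf; rewrite 2!grid_avgD grid_avgZ.
have -> : grid_avg n (fun=> - (h * (2 * (K1 + 1) + 1)) : R) =
    - (h * (2 * (K1 + 1) + 1)) := @grid_avg_cst _ N n _.
move=> /le_trans/(_ (C3P n)) H.
have C3n : C3 / n.+1%:R <= h.
  rewrite ler_pdivrMr// mulrC -ler_pdivrMr// ltW//.
  by rewrite (lt_le_trans (truncnS_gt _))// ler_nat ltnS.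
rewrite -(ler_pM2l h0).
set X := grid_avg n _.
have {}H : grid_avg n f + h * X + - (h * (2 * (K1 + 1) + 1)) <=
  grid_avg n f + C3 / n.+1%:R := H.
have -> : h * (2 * (K1 + 1) + 2) = h * (2 * (K1 + 1) + 1) + h by ring.
move: H; rewrite -addrA lerD2l lerBlDr => /le_trans; apply.
by rewrite addrC lerD2l.
Qed.

Hypothesis ED : forall y, E y -> 0 <= \sum_i D i y.
Hypothesis N0 : (0 < N)%N.

(** Apply the Chebyshev inequality to a normalized shift of [f * S], where [f] is the truncated
    logarithm of the distance and [S] the sum of the [D i]. Its average is bounded uniformly in [e],
    while near the set [f] is of order [- ln e] and [S] at least [eta / 2]. *)
Lemma lebesgue_nullN_expanding_cube eta : 0 < eta ->
  lebesgue_nullN [set y | [/\ E y, eta <= \sum_i D i y &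
    forall j, 0 <= y j < 2 * pi]].
Proof.
move=> eta0; have [E0|/set0P E0] := eqVneq E set0.
  apply: (@lebesgue_nullN_subset _ _ _ [set fun=> 0]); last exact: lebesgue_nullN_set1.
  by move=> y [+ _ _]; rewrite E0.
have [Q Q0 avgQ] := grid_avg_log_cutoff_divergence E0.
have [KD KD0 [DKb DL]] := regular_common_bound Dr.
pose S x := \sum_i D i x; pose nK : R := N%:R * KD.
have nK0 : 0 <= nK by rewrite mulr_ge0.
have SL x y : S y - nK * dist1 x y <= S x.
  have : `|S x - S y| <= (size (index_enum 'I_N))%:R * (KD * dist1 x y).
    by rewrite /S -sumrB; apply: norm_sum_le_size => i; exact: DL.
  have -> : size (index_enum 'I_N) = N.
    by rewrite -sum1_size big_const_ord iter_addn_0 mul1n.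
  by rewrite mulrA -/nK ler_norml => /andP[]; lra.
(* [S] is nonnegative on [E] and Lipschitz, so off [E] it is negative by at most a multiple of the
   distance. *)
have SE x : - (nK * dist_set E x) <= S x.
  apply/ler_addgt0Pr => c c0; have nK1 : 0 < nK + 1 by lra.
  have [y Ey xy] := dist_set_adherent E0 x (divr_gt0 c0 nK1).
  have := SL x y; have := ED Ey; rewrite -/(S y).
  have : nK * dist1 x y <= nK * (dist_set E x + c / (nK + 1)).
    by rewrite ler_wpM2l// ltW.
  have : nK * (c / (nK + 1)) <= c.
    by rewrite mulrCA ler_piMr ?(ltW c0)// ler_pdivrMr//; lra.
  by rewrite mulrDr; lra.
apply: lebesgue_nullN_grid_avg => // [y []//|eps eps0].
(* [V] brings the average below [eps]; [k] makes [f] at least [2 * V / eta] within distance [e] of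
   [E]; [r] keeps [S] at least [eta / 2] near the set, so that [f * S] reaches [V] there. *)
pose V : R := (Q + nK) / eps + 1.
have QK : 0 <= (Q + nK) / eps by rewrite divr_ge0 ?addr_ge0// ltW.
have V0 : 0 < V by rewrite ltr_wpDl.
pose k : R := 1 + 2 * V / eta; pose e := expR (- k).
have k1 : 1 < k by rewrite ltrDl divr_gt0// mulr_gt0.
have e01 : 0 < e < 1 by rewrite expR_gt0 expR_lt1; lra.
have /andP[e0 e1] := e01.
have eta1 : 0 < eta / (2 * (nK + 1)) by rewrite divr_gt0// mulr_gt0//; lra.
pose r : R := Num.min e (eta / (2 * (nK + 1))).
have r0 : 0 < r by rewrite lt_min e0.
have [n0 n0P] := avgQ e e01.
pose n := maxn n0 (Num.truncn (N%:R * (2 * pi) / r)).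
have nr : N%:R * (2 * pi / n.+1%:R) <= r.
  rewrite mulrA ler_pdivrMr// [leRHS]mulrC -ler_pdivrMr// ltW//.
  by rewrite (lt_le_trans (truncnS_gt _))// ler_nat ltnS leq_maxr.
pose f x := log_cutoff e (dist_set E x).
have fS0 x : 0 <= f x * S x + nK.
  have d0 := dist_set_ge0 E0 x.
  have := log_cutoff_mul e01 d0; rewrite -/(f x) => fd.
  have : f x * - (nK * dist_set E x) <= f x * S x.
    by rewrite ler_wpM2l// log_cutoff_ge0.
  have : nK * (dist_set E x * f x) <= nK by rewrite ler_piMr.
  lra.
exists n, (fun x => V^-1 * (f x * S x + nK)); split=> [x||x y [Ey etay _] xy].
- by rewrite mulr_ge0 ?invr_ge0 ?(ltW V0).
- rewrite grid_avgZ grid_avgD grid_avg_cst ler_pdivrMl//.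
  apply: (@le_trans _ _ (Q + nK)).
    by rewrite lerD2r; apply: n0P; rewrite leq_maxl.
  by rewrite /V mulrDl divfK ?gt_eqF// lerDl mul1r ltW.
have xyr : dist1 x y <= r := le_trans (dist1_le_bound xy) nr.
have fx : 2 * V / eta <= f x.
  have dx : 0 <= dist_set E x <= e.
    rewrite dist_set_ge0// (le_trans (dist_set_le E0 x Ey))// (le_trans xyr)//.
    by rewrite ge_min lexx.
  have := log_cutoff_near0 e01 dx; rewrite -/(f x) /e expRK /k; lra.
have Sx : eta / 2 <= S x.
  have : nK * dist1 x y <= eta / 2.
    apply: (@le_trans _ _ (nK * (eta / (2 * (nK + 1))))).
      by rewrite ler_wpM2l// (le_trans xyr)// ge_min lexx orbT.
    have -> : nK * (eta / (2 * (nK + 1))) = (eta / 2) * (nK / (nK + 1)).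
      by field; rewrite gt_eqF//; lra.
    by rewrite ler_piMr ?divr_ge0 ?(ltW eta0)// ler_pdivrMr; lra.
  have := SL x y; rewrite -/(S y) in etay; lra.
rewrite ler_pdivlMl// mulr1.
have : 2 * V / eta * (eta / 2) <= f x * S x.
  by apply: ler_pM => //; rewrite ?divr_ge0 ?mulr_ge0// ltW.
have -> : 2 * V / eta * (eta / 2) = V by field; rewrite gt_eqF.
lra.
Qed.

(** Countably many cases: a threshold [1 / (m + 1)] for the divergence and a lattice translate of
    the fundamental cube. *)
Theorem lebesgue_nullN_expanding :
  lebesgue_nullN [set x | E x /\ 0 < \sum_i D i x].
Proof.
pose A (m : nat) := [set y | [/\ E y, m.+1%:R^-1 <= \sum_i D i y &
    forall j, 0 <= y j < 2 * pi]].
apply: (@lebesgue_nullN_subset _ _ _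
    (\bigcup_(p : nat * {ffun 'I_N -> int})
       [set x | A p.1 (lattice_shift p.2 x)])).
  move=> x [Ex Sx].
  pose z := [ffun j => - Num.floor (x j / (2 * pi))] : {ffun 'I_N -> int}.
  pose m := Num.truncn ((\sum_i D i x)^-1).
  exists (m, z) => //; split=> /= [||j]; first exact: EP.
    have [_ _ ->] := regular_sum (index_enum 'I_N) Dr.
    rewrite invf_ple ?posrE// ltW//; exact: truncnS_gt.
  have p0 : 0 < 2 * pi :> R by rewrite mulr_gt0// pi_gt0.
  have /andP[] := floor_itv (x j / (2 * pi)).
  rewrite ler_pdivlMr// ltr_pdivrMr// intrD /lattice_shift ffunE intrN.
  set c := (Num.floor _)%:~R; lra.
apply: lebesgue_nullN_bigcup => // -[m z]; apply: lebesgue_nullN_lattice_shift.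
by apply: lebesgue_nullN_expanding_cube; rewrite invr_gt0.
Qed.

End ExpandingSets.

(** * Trapping and limits *)

Section Trapping.
Variable R : realType.

Lemma is_derive_continuous (u : R -> R) (t d : R) :
  is_derive t 1 u d -> {for t, continuous u}.
Proof. by move=> [du _]; apply/differentiable_continuous/derivable1_diffP. Qed.

Lemma is_derive_lt0_right (u : R -> R) (t d : R) : is_derive t 1 u d -> d < 0 ->
  exists2 e, 0 < e & forall s, t < s < t + e -> u s < u t.
Proof.
move=> [du dE] d0.
have H : (h^-1 *: (u (h + t) - u t) @[h --> 0^']) --> d.
  move: du; rewrite /derivable -dE /derive /= => du.
  have E : (fun h : R => h^-1 *: (u (h *: (1 : R) + t) - u t)) =
      (fun h => h^-1 *: (u (h + t) - u t)).
    by apply/funext => h; rewrite /GRing.scale/= mulr1.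
  by move: du; rewrite E.
have [e /= e0 He] := cvgr_lt d H 0 d0.
exists e => // s /andP[ts se].
have := He (s - t); rewrite /ball_/= sub0r normrN gtr0_norm ?subr_gt0//.
rewrite subr_eq0 gt_eqF// subrK => /(_ _ isT); rewrite ltrBlDl => /(_ se).
by rewrite /GRing.scale/= pmulr_rlt0 ?invr_gt0 ?subr_gt0// subr_lt0.
Qed.

Lemma continuous_lt_right (u : R -> R) (t a : R) : {for t, continuous u} ->
  u t < a -> exists2 e, 0 < e & forall s, `|s - t| < e -> u s < a.
Proof.
move=> uc ua; have [e /= e0 He] := cvgr_lt _ uc _ ua.
by exists e => // s st; apply: He; rewrite /ball_/= distrC.
Qed.

(** Let [T] be the infimum of the times of violation. By continuity all constraints hold at [T], and
    each persists a little to the right: a strict one by continuity, a tight one by its negative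
    derivative. Finiteness gives a common interval, a contradiction. The sign condition is asked
    only where all constraints hold, which permits bootstrap arguments. *)
Lemma finite_trap (J : finType) (u du : J -> R -> R) (a : J -> R) (t1 : R) :
  (forall j t, t1 <= t -> is_derive t 1 (u j) (du j t)) ->
  (forall j, u j t1 <= a j) ->
  (forall t, t1 <= t -> (forall j, u j t <= a j) ->
     forall j, u j t = a j -> du j t < 0) ->
  forall t, t1 <= t -> forall j, u j t <= a j.
Proof.
move=> ud ua barrier t2 t12 j2; rewrite leNgt; apply/negP => j2a.
pose B := [set t | t1 <= t /\ exists j, a j < u j t].
have B0 : has_inf B.
  by split; [exists t2; split=> //; exists j2|exists t1 => t []].
have Bt t : t1 <= t < inf B -> forall j, u j t <= a j.
  move=> /andP[t1t tB] j; rewrite leNgt; apply/negP => jt.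
  by have := ge_inf B0.2 (conj t1t (ex_intro _ j jt)); rewrite leNgt tB.
set T := inf B in Bt.
have T1 : t1 <= T by apply: lb_le_inf; [exact: B0.1|move=> t []].
have uT j : u j T <= a j.
  rewrite leNgt; apply/negP => ajT.
  have [TE|t1T] := eqVneq t1 T; first by have := ua j; rewrite TE leNgt ajT.
  have {}t1T : t1 < T by rewrite lt_neqAle t1T.
  have NT : - u j T < - a j by rewrite ltrN2.
  have cN : {for T, continuous (fun t => - u j t)}.
    by apply: continuousN; exact: is_derive_continuous (ud j T T1).
  have [e e0 He] := continuous_lt_right cN NT.
  pose s := Num.max t1 (T - e / 2).
  have sT : s < T by rewrite gt_max t1T/=; lra.
  have := Bt s _ j; rewrite sT le_max lexx/= => /(_ isT).
  have := He s; rewrite ltrN2 distrC gtr0_norm ?subr_gt0// => H.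
  rewrite leNgt H// ltrBlDl -ltrBlDr lt_max; apply/orP; right; lra.
have right j : exists2 e, 0 < e & forall s, T < s < T + e -> u j s <= a j.
  have := uT j; rewrite le_eqVlt => /orP[/eqP ujT|ujT].
    have [e e0 He] := is_derive_lt0_right (ud j T T1) (barrier T T1 uT j ujT).
    by exists e => // s /He; rewrite ujT => /ltW.
  have [e e0 He] := continuous_lt_right (is_derive_continuous (ud j T T1)) ujT.
  exists e => // s /andP[Ts se]; apply/ltW/He.
  by rewrite gtr0_norm ?subr_gt0// ltrBlDl.
have /choice[e eP] : forall j, exists e, 0 < e /\ forall s, T < s < T + e -> u j s <= a j.
  by move=> j; have [e e0 He] := right j; exists e.
pose m := \big[Num.min/1]_j e j.
have m0 : 0 < m by apply: lt_bigmin => // j _; exact: (eP j).1.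
have [s [t1s [j js]] sm] := inf_adherent m0 B0.
have Ts : T <= s by apply: ge_inf; [exact: B0.2|split=> //; exists j].
have [TE|Ts'] := eqVneq T s; first by have := uT j; rewrite TE leNgt js.
have {}Ts : T < s by rewrite lt_neqAle Ts'.
have := (eP j).2 s; rewrite Ts/= leNgt js/= => H.
suff : false by []. apply: H; rewrite (lt_le_trans sm)// lerD2l.
exact: bigmin_le_cond.
Qed.

Lemma liminf_infty_ge (f : R -> R) (T c : R) : (forall t, T <= t -> c <= f t) ->
  (c%:E <= liminf_infty f)%E.
Proof.
move=> fc; rewrite /liminf_infty limf_einfE; apply: le_ereal_sup_tmp.
exists (ereal_inf ((fun t => (f t)%:E) @` [set t | T <= t])).
  exists [set t | T <= t] => //; exists T; split; first exact: num_real.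
  by move=> t /ltW.
by apply: le_ereal_inf_tmp => _ [t /= Tt <-]; rewrite lee_fin fc.
Qed.

Lemma limsup_infty_le (f : R -> R) (T c : R) : (forall t, T <= t -> f t <= c) ->
  (limsup_infty f <= c%:E)%E.
Proof.
move=> fc; rewrite /limsup_infty limf_esupE; apply: ge_ereal_inf.
exists (ereal_sup ((fun t => (f t)%:E) @` [set t | T <= t])).
  exists [set t | T <= t] => //; exists T; split; first exact: num_real.
  by move=> t /ltW.
by apply: ge_ereal_sup => _ [t /= Tt <-]; rewrite lee_fin fc.
Qed.

Lemma liminf_infty_le_limsup_infty (f : R -> R) :
  (liminf_infty f <= limsup_infty f)%E.
Proof.
rewrite /limsup_infty limf_esupE; apply: le_ereal_inf_tmp => _ [V VF <-].
rewrite /liminf_infty limf_einfE; apply: ge_ereal_sup => _ [V' VF' <-].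
have [t [Vt V't]] := filter_ex (filterI VF VF').
apply: (@le_trans _ _ (f t)%:E).
  by apply: ereal_inf_lbound; exists t.
by apply: ereal_sup_ubound; exists t.
Qed.

Lemma eventual_oscillation (f : R -> R) (T a b : R) :
  (forall t, T <= t -> a <= f t <= b) -> exists ls li : R,
  limsup_infty f = ls%:E /\ liminf_infty f = li%:E /\ ls - li <= b - a.
Proof.
move=> fab.
have fa := @liminf_infty_ge f T a (fun t Tt => (andP (fab t Tt)).1).
have fb := @limsup_infty_le f T b (fun t Tt => (andP (fab t Tt)).2).
have fl := liminf_infty_le_limsup_infty f.
have i1 : liminf_infty f \is a fin_num.
  by rewrite fin_numElt (lt_le_trans (ltNyr a) fa)
    (le_lt_trans (le_trans fl fb) (ltry b)).
have i2 : limsup_infty f \is a fin_num.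
  by rewrite fin_numElt (lt_le_trans (ltNyr a) (le_trans fa fl))
    (le_lt_trans fb (ltry b)).
exists (fine (limsup_infty f)), (fine (liminf_infty f)).
rewrite !fineK//; split=> //; split=> //; apply: lerB.
  by rewrite -lee_fin fineK.
by rewrite -lee_fin fineK.
Qed.

End Trapping.

(** * The Winfree model *)

Section Winfree.
Variables (R : realType) (S I : R -> R).
Hypotheses (SP : periodic2pi S) (IP : periodic2pi I).

Lemma periodic2pi_int (f : R -> R) (x : R) (z : int) : periodic2pi f ->
  f (x + 2 * pi * z%:~R) = f x.
Proof.
move=> fP.
have fn n y : f (y + 2 * pi * n%:R) = f y.
  elim: n => [|n IH]; first by rewrite mulr0 addr0.
  by rewrite -[n.+1%:R]natr1 mulrDr mulr1 addrA fP.
case: z => n; first exact: fn.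
by rewrite NegzE -(fn n.+1 (x + _)) mulrNz mulrN addrNK.
Qed.

Lemma reduce2pi (x : R) : exists z : int, - pi <= x - 2 * pi * z%:~R <= pi.
Proof.
exists (Num.floor ((x + pi) / (2 * pi))).
have p0 : 0 < 2 * pi :> R by rewrite mulr_gt0// pi_gt0.
have /andP[] := floor_itv ((x + pi) / (2 * pi)).
rewrite ler_pdivlMr// ltr_pdivrMr// intrD.
set c := (Num.floor _)%:~R; lra.
Qed.

Lemma periodic_lipschitz_regular (N : nat) (f : R -> R) (j : 'I_N) :
  periodic2pi f -> lipschitzR f -> regular (fun x => f (x j)).
Proof.
move=> fP [L fL]; split.
- exists `|L| => // x y; apply: le_trans (fL _ _) _.
  apply: (@le_trans _ _ (`|L| * `|x j - y j|)).
    by rewrite ler_wpM2r// ler_norm.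
  by rewrite ler_wpM2l// ler_dist1.
- exists (`|f 0| + `|L| * pi) => [|x].
    by rewrite addr_ge0// mulr_ge0// pi_ge0.
  have [z xz] := reduce2pi (x j).
  have -> : f (x j) = f (x j - 2 * pi * z%:~R).
    by rewrite -mulrN -intrN periodic2pi_int.
  set y := x j - _ in xz *.
  have -> : f y = f 0 + (f y - f 0) by ring.
  rewrite (le_trans (ler_normD _ _))// lerD2l (le_trans (fL _ _))// subr0.
  apply: (@le_trans _ _ (`|L| * `|y|)); first by rewrite ler_wpM2r// ler_norm.
  by rewrite ler_wpM2l// ler_norml.
- by move=> z x; rewrite /lattice_shift periodic2pi_int.
Qed.

(** * The vector field, its divergence and the incoherent initial data *)

Variables (N : nat) (omega : 'I_N -> R) (kappa : R).

Definition winfree_field (i : 'I_N) (x : 'I_N -> R) : R :=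
  omega i + kappa / N%:R * \sum_(j < N) I (x j) * S (x i).

Hypotheses (SL : lipschitzR S) (IL : lipschitzR I).

Lemma winfree_field_regular i : regular (winfree_field i).
Proof.
apply: regularD; first exact: regular_cst.
apply: regularM; first exact: regular_cst.
by apply: regular_sum => j; apply: regularM; exact: periodic_lipschitz_regular.
Qed.

Variables (c4 Istar : R).
Hypotheses (Sd : forall x, derivable S x 1) (Id : forall x, derivable I x 1).
Hypotheses (N0 : (0 < N)%N) (k0 : 0 < kappa) (c40 : 0 < c4).
Hypothesis I0 : forall x, 0 <= I x.
Hypothesis SI : forall x, c4 * (Istar - I x) <= derive1 S x.
Hypothesis IS : forall x, 0 <= derive1 I x * S x.

(** Lower bound for the [i]-th diagonal derivative of the field; the sum over [i] is N kappa c4 R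
    (I_* - R). *)
Definition divergence_bound (i : 'I_N) (x : 'I_N -> R) : R :=
  kappa / N%:R * c4 * \sum_(j < N) I (x j) * (Istar + -1 * I (x i)).

Lemma divergence_bound_regular i : regular (divergence_bound i).
Proof.
apply: regularM; first exact: regular_cst.
apply: regular_sum => j; apply: regularM; first exact: periodic_lipschitz_regular.
apply: regularD; first exact: regular_cst.
by apply: regularM; [exact: regular_cst|exact: periodic_lipschitz_regular].
Qed.

Let kN0 : 0 < kappa / N%:R. Proof. by rewrite divr_gt0// ltr0n. Qed.

(** The product rule gives [kappa / N] times the total influence times [S'], plus [kappa / N] times
    [I' * S]. The second term is nonnegative, and the hypothesis on [S'] bounds the first from
    below. *)
Lemma winfree_field_derive i (x : 'I_N -> R) (u : R) :
  derivable (fun v => winfree_field i (upd x i v)) u 1 /\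
  divergence_bound i (upd x i u) <=
    derive1 (fun v => winfree_field i (upd x i v)) u.
Proof.
pose A : R := \sum_(j < N | j != i) I (x j).
have sumA (v c : R) : \sum_(j < N) I (upd x i v j) * c = (I v + A) * c.
  rewrite -mulr_suml (bigD1 i)//= upd_same; congr ((_ + _) * _).
  by apply: eq_bigr => j /negPf ji; rewrite /upd ji.
have -> : (fun v => winfree_field i (upd x i v)) =
    (fun v => omega i + kappa / N%:R * ((I v + A) * S v)).
  by apply/funext => v; rewrite /winfree_field upd_same sumA.
have dS : is_derive u 1 S (derive1 S u) by rewrite derive1E; exact: derivableP.
have dI : is_derive u 1 I (derive1 I u) by rewrite derive1E; exact: derivableP.
pose d := kappa / N%:R * ((I u + A) * derive1 S u + S u * derive1 I u).
have dd : is_derive u 1 (fun v => omega i + kappa / N%:R * ((I v + A) * S v)) d.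
  rewrite -[d]add0r; apply: is_deriveD.
  apply: (@is_deriveZ _ _ _ (fun v => (I v + A) * S v) (kappa / N%:R) u 1).
  apply: (@is_deriveM _ _ (fun v => I v + A) S).
  by rewrite -[derive1 I u]addr0; apply: is_deriveD.
split; first by case: dd.
rewrite derive1E derive_val /divergence_bound upd_same sumA /d -mulrA ler_pM2l//.
have A0 : 0 <= A by exact: sumr_ge0.
have IA : 0 <= I u + A by rewrite addr_ge0.
have := IS u; have := ler_wpM2l IA (SI u); lra.
Qed.

Lemma divergence_bound_sum (x : 'I_N -> R) : \sum_i divergence_bound i x =
  kappa / N%:R * c4 * ((\sum_j I (x j)) * (N%:R * Istar - \sum_j I (x j))).
Proof.
rewrite -mulr_sumr; congr (_ * _).
under eq_bigr do rewrite -mulr_suml.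
rewrite -mulr_sumr big_split/= sumr_const card_ord -mulr_sumr mulN1r.
by rewrite mulr_natl.
Qed.

(** Asking for some solution defines the exceptional set without a flow: any solution that stays
    below the threshold puts its initial datum in it. The margin [Istar / (4 * N)] is what
    [sum_large_part] turns into a surplus. *)
Definition incoherent (theta0 : 'I_N -> R) : Prop :=
  exists theta, is_solution S I omega kappa theta0 theta /\
  forall t, 0 <= t -> order_param I theta t <= Istar - Istar / (4 * N%:R).

Lemma incoherent_lattice_shift z y : incoherent y -> incoherent (lattice_shift z y).
Proof.
move=> [th [[th0 thd] thR]]; exists (fun i t => th i t + 2 * pi * (z i)%:~R).
have Ez f i t : periodic2pi f -> f (th i t + 2 * pi * (z i)%:~R) = f (th i t).
  exact: periodic2pi_int.
split; last first.
  move=> t /thR; rewrite /order_param.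
  by under [X in _ -> _ * X <= _]eq_bigr do rewrite (Ez I)//.
split=> [i|i t t0]; first by rewrite /lattice_shift th0.
have [dth <-] : derivable (th i) t 1 /\ derive1 (th i) t =
   omega i + kappa / N%:R * \sum_(j < N) I (th j t + 2 * pi * (z j)%:~R) *
     S (th i t + 2 * pi * (z i)%:~R).
  by under eq_bigr do rewrite (Ez I)// (Ez S)//; exact: thd.
have H : is_derive t 1 (fun s => th i s + 2 * pi * (z i)%:~R) (derive1 (th i) t).
  rewrite -[derive1 _ _]addr0; apply: is_deriveD.
  by rewrite derive1E; exact: derivableP.
by split; [case: H|rewrite derive1E derive_val].
Qed.

Lemma solution_derive theta0 theta : is_solution S I omega kappa theta0 theta ->
  forall i (t : R), 0 <= t ->
  is_derive t 1 (theta i) (winfree_field i (fun j => theta j t)).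
Proof.
move=> [_ sol] i t t0; have [d dE] := sol i t t0.
by rewrite /winfree_field -dE derive1E; exact: derivableP.
Qed.

(** Take the position at time [h] of an incoherent solution; a shift of time keeps it incoherent.
    The mean value theorem, used twice, compares it with the Euler step. *)
Lemma incoherent_step : exists2 C : R, 0 <= C &
  forall h, 0 <= h <= 1 -> forall y, incoherent y ->
  exists2 y', incoherent y' &
    forall j, `|y' j - y j - h * winfree_field j y| <= C * h ^+ 2.
Proof.
have [K K0 [FK FL]] := regular_common_bound winfree_field_regular.
exists (K * (N%:R * K)); first by rewrite !mulr_ge0.
move=> h /andP[h0 h1] y [th [sol thR]].
have der := solution_derive sol; have [th0 thd] := sol.
have thc i (s t : R) : 0 <= s -> s <= t ->
    exists2 c, s <= c <= t & th i t - th i s =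
      winfree_field i (fun j => th j c) * (t - s).
  move=> s0 st; have [r|r|c cst ->] := MVT_segment (f := th i)
    (df := fun r => winfree_field i (fun j => th j r)) st.
  - by rewrite in_itv/= => /andP[sr _]; apply: der; rewrite (le_trans s0)// ltW.
  - apply: derivable_within_continuous => r'; rewrite in_itv/= => /andP[sr _].
    by have [] := der i r' (le_trans s0 sr).
  - by exists c.
exists (fun j => th j h).
  exists (fun i t => th i (t + h)); split; last first.
    by move=> t t0; apply: thR; rewrite addr_ge0.
  split=> [i|i t t0]; first by rewrite add0r.
  have th1 : 0 <= t + h by rewrite addr_ge0.
  have H : is_derive t 1 (fun s => th i (s + h))
      (winfree_field i (fun j => th j (t + h)) * 1).
    apply: (@is_derive1_comp _ (th i) (fun s => s + h)); first exact: der.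
    exact: is_derive_shift.
  by split; [case: H|rewrite derive1E derive_val mulr1].
move=> j; rewrite -th0; have [c /andP[c0 ch]] := thc j 0 h (lexx _) h0.
rewrite subr0 => E.
have -> : winfree_field j y = winfree_field j (fun k => th k 0).
  by congr winfree_field; apply/funext => k; rewrite th0.
rewrite E mulrC -mulrBr normrM ger0_norm//.
have -> : K * (N%:R * K) * h ^+ 2 = h * (K * (N%:R * (h * K))) by ring.
rewrite ler_wpM2l// (le_trans (FL _ _ _))// ler_wpM2l// dist1_le_bound// => k.
have [c' _ ->] := thc k 0 c (lexx _) c0.
by rewrite subr0 normrM mulrC (ger0_norm c0) ler_pM.
Qed.

Hypothesis Ipos : forall x, - pi < x < pi -> 0 < I x.
Hypothesis Istar0 : 0 < Istar.

Lemma zero_influence (x : R) : I x = 0 -> exists z : int, x = pi + 2 * pi * z%:~R.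
Proof.
move=> Ix0; have [z /andP[xz zx]] := reduce2pi x.
set y := x - _ in xz zx.
have Iy : I y = 0 by rewrite -Ix0 /y -mulrN -intrN periodic2pi_int.
have [yl|yl] := eqVneq (- pi) y.
  by exists (z - 1); rewrite intrB; move: yl; rewrite /y; lra.
have [yr|yr] := eqVneq y pi.
  by exists z; move: yr; rewrite /y; lra.
have : 0 < I y by apply: Ipos; rewrite !lt_neqAle yl yr xz.
by rewrite Iy ltxx.
Qed.

Lemma incoherent_divergence y : incoherent y ->
  0 <= \sum_j I (y j) /\ \sum_j I (y j) < N%:R * Istar.
Proof.
move=> [th [[th0 _] /(_ 0 (lexx _))]]; rewrite /order_param.
under eq_bigr do rewrite th0.
have n0 : 0 < N%:R :> R by rewrite ltr0n.
rewrite ler_pdivrMl// => H; split; first exact: sumr_ge0.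
apply: le_lt_trans H _; rewrite ltr_pM2l// gtrBl divr_gt0// mulr_gt0//.
Qed.

(** On incoherent data the divergence bound is positive unless all influences vanish, and then every
    angle is [pi] modulo [2 * pi], which leaves countably many points. *)
Lemma lebesgue_nullN_incoherent : lebesgue_nullN incoherent.
Proof.
apply: (@lebesgue_nullN_subset _ _ _ (\bigcup_(b : bool)
   if b then [set x | incoherent x /\ 0 < \sum_i divergence_bound i x] else
   \bigcup_(z : {ffun 'I_N -> int}) [set fun j => pi + 2 * pi * (z j)%:~R])).
  move=> x xi; have [s0 s1] := incoherent_divergence xi.
  have [s00|sn] := eqVneq (\sum_j I (x j)) 0.
    exists false => //=.
    have /choice[z zP] : forall j, exists z : int, x j = pi + 2 * pi * z%:~R.
      move=> j; apply: zero_influence; move: s00; rewrite (bigD1 j)//=.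
      move/eqP; rewrite paddr_eq0// ?sumr_ge0// => /andP[/eqP]//.
    exists [ffun j => z j] => //=; apply/funext => j.
    by rewrite ffunE zP.
  exists true => //=; split=> //; rewrite divergence_bound_sum.
  have sp : 0 < \sum_j I (x j) by rewrite lt_neqAle eq_sym sn.
  apply: mulr_gt0; first exact: mulr_gt0.
  by apply: mulr_gt0 => //; rewrite subr_gt0.
apply: lebesgue_nullN_bigcup => // -[]; last first.
  by apply: lebesgue_nullN_bigcup => // z; exact: lebesgue_nullN_set1.
apply: (@lebesgue_nullN_expanding _ _ winfree_field) => //.
- exact: winfree_field_regular.
- exact: divergence_bound_regular.
- exact: winfree_field_derive.
- exact: incoherent_lattice_shift.
- exact: incoherent_step.
move=> y yi; have [s0 s1] := incoherent_divergence yi.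
rewrite divergence_bound_sum; apply: mulr_ge0; first by rewrite ltW// mulr_gt0.
by apply: mulr_ge0 => //; rewrite subr_ge0 ltW.
Qed.

(** * Trapping arcs and oscillator death *)

Variables (alpha0 p q c1 c2 c3 : R).
Hypotheses (a0 : 0 < alpha0 < pi) (p1 : 1 <= p) (q1 : 1 <= q)
  (c10 : 0 < c1) (c20 : 0 < c2) (c30 : 0 < c3).
Hypothesis Sright : forall th, alpha0 <= th <= pi -> S th <= - (c1 * (pi - th) `^ p).
Hypothesis Sleft : forall th, - pi <= th <= - alpha0 -> c1 * (th + pi) `^ p <= S th.
Hypothesis Iq : forall th, - pi <= th <= pi -> I th <= c2 * (pi - `|th|) `^ q.
Hypothesis Ic3 : forall th, - pi <= th <= pi ->
  forall ph, `|ph| <= Num.max `|th| alpha0 -> c3 * I th <= I ph.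
Hypothesis kappa1 : 2 * (2 * c2) `^ (p / q) / (c1 * c3) *
  (supnorm omega / Istar `^ (1 + p / q)) < kappa.
Hypothesis kappa2 : 2 / (c1 * c3 * (pi - alpha0) `^ p) * (supnorm omega / Istar)
  < kappa.

Lemma supnorm_ge i : `|omega i| <= supnorm omega.
Proof. exact: le_bigmax_cond. Qed.

(** The inequality makes the pull of [S] at [a] and [- a] beat every natural frequency as soon as R
    is at least [c3 * Istar / 2]. *)
Definition barrier (a : R) : Prop :=
  alpha0 <= a <= pi /\
  supnorm omega < kappa * (c3 * Istar / 2) * (c1 * (pi - a) `^ p).

Lemma barrier_alpha0 : barrier alpha0.
Proof.
have /andP[a00 a0pi] := a0; split; first by rewrite lexx ltW.
have X0 : 0 < (pi - alpha0) `^ p by rewrite powR_gt0// subr_gt0.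
move: kappa2; set X := (pi - alpha0) `^ p in X0 *.
have -> : 2 / (c1 * c3 * X) * (supnorm omega / Istar) =
    supnorm omega / (c3 * Istar / 2 * (c1 * X)).
  by field; rewrite !gt_eqF.
by rewrite ltr_pdivrMr ?mulrA// !mulr_gt0// invr_gt0.
Qed.

(** Raising the hypothesis to the power [p / q] bounds the [p]-th power of [pi - a] from below; the
    first lower bound on [kappa] then applies. *)
Lemma barrier_influence a : alpha0 <= a <= pi -> Istar / 2 <= c2 * (pi - a) `^ q ->
  barrier a.
Proof.
move=> /andP[a0a api] Ia; split; first by rewrite a0a.
have q0 : 0 < q := lt_le_trans ltr01 q1.
have pq0 : 0 < p / q by rewrite divr_gt0// (lt_le_trans ltr01 p1).
have Y0 : 0 < Istar `^ (p / q) by exact: powR_gt0.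
have Z0 : 0 < (2 * c2) `^ (p / q) by rewrite powR_gt0 ?mulr_gt0.
have YZ : Istar `^ (p / q) <= (2 * c2) `^ (p / q) * (pi - a) `^ p.
  have -> : (pi - a) `^ p = ((pi - a) `^ q) `^ (p / q).
    by rewrite -powRrM mulrCA divff ?mulr1// gt_eqF.
  rewrite -powRM ?powR_ge0 ?mulr_ge0 ?(ltW c20)//.
  apply: ge0_ler_powR; rewrite ?nnegrE ?(ltW pq0) ?(ltW Istar0)//.
    by rewrite !mulr_ge0 ?powR_ge0// ltW.
  by move: Ia; lra.
move: kappa1; rewrite powRD; last by rewrite (gt_eqF Istar0) implybT.
rewrite powRr1 ?(ltW Istar0)//.
move: Y0 Z0 YZ; set Y := Istar `^ _; set Z := (2 * c2) `^ _; set X := _ `^ p.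
move=> Y0 Z0 YZ.
have -> : 2 * Z / (c1 * c3) * (supnorm omega / (Istar * Y)) =
    supnorm omega * Z / (c3 * Istar / 2 * c1 * Y).
  by field; rewrite !gt_eqF.
have cc0 : 0 < c3 * Istar / 2 * c1 by rewrite !mulr_gt0// invr_gt0.
rewrite ltr_pdivrMr; last exact: mulr_gt0.
move=> H; rewrite -(ltr_pM2r Z0); apply: lt_le_trans H _.
have -> : kappa * (c3 * Istar / 2) * (c1 * X) * Z =
  kappa * (c3 * Istar / 2 * c1 * (Z * X)) by ring.
by rewrite ler_pM2l// ler_pM2l.
Qed.

(** The sign treats both endpoints of the arc at once: [b = false] is the right one, [b = true] the
    left one. *)
Lemma barrier_inward i a Rt (x : 'I_N -> R) (z : int) (b : bool) : barrier a ->
  c3 * Istar / 2 <= Rt -> Rt = N%:R^-1 * \sum_j I (x j) ->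
  (-1) ^+ b * (x i - 2 * pi * z%:~R) = a ->
  (-1) ^+ b * winfree_field i x < 0.
Proof.
move=> [/andP[a0a api] wa] RtI RtE xa; have /andP[a00 _] := a0.
have -> : winfree_field i x = omega i + kappa * Rt * S (x i).
  by rewrite /winfree_field -mulr_suml RtE !mulrA.
have xE : x i = (-1) ^+ b * a + 2 * pi * z%:~R.
  by rewrite -xa mulrA -signr_addb addbb expr0 mul1r subrK.
have -> : S (x i) = S ((-1) ^+ b * a) by rewrite xE periodic2pi_int.
have Sa : (-1) ^+ b * S ((-1) ^+ b * a) <= - (c1 * (pi - a) `^ p).
  case: b {xa xE} => /=; rewrite ?expr1 ?expr0 ?mulN1r ?mul1r.
    rewrite lerN2; have := Sleft (th := - a); rewrite addrC; apply; lra.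
  by apply: Sright; rewrite a0a.
have wo : (-1) ^+ b * omega i <= supnorm omega.
  by apply: le_trans (supnorm_ge i); rewrite -[leRHS](normrMsign b) ler_norm.
have X0 : 0 <= c1 * (pi - a) `^ p by rewrite mulr_ge0 ?powR_ge0// ltW.
have kR : 0 <= kappa * Rt.
  by rewrite mulr_ge0 ?(ltW k0)// (le_trans _ RtI)// !mulr_ge0 ?invr_ge0// ltW.
have H1 := ler_wpM2l kR Sa.
have H2 : kappa * (c3 * Istar / 2) * (c1 * (pi - a) `^ p) <=
    kappa * Rt * (c1 * (pi - a) `^ p).
  by rewrite ler_wpM2r// ler_pM2l.
rewrite mulrDr mulrCA; lra.
Qed.

Variables (theta0 : 'I_N -> R) (theta : 'I_N -> R -> R).
Hypothesis sol : is_solution S I omega kappa theta0 theta.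

(** [finite_trap] over [K * bool], each arc being two one-sided constraints. The lower bound on R
    may itself be deduced from the trapping. *)
Lemma winfree_trap (K : finType) (idx : K -> 'I_N) (z : K -> int) (a : K -> R)
    (t1 : R) : 0 <= t1 -> (forall k, barrier (a k)) ->
  (forall k, `|theta (idx k) t1 - 2 * pi * (z k)%:~R| <= a k) ->
  (forall t, t1 <= t ->
     (forall k, `|theta (idx k) t - 2 * pi * (z k)%:~R| <= a k) ->
     c3 * Istar / 2 <= order_param I theta t) ->
  forall t, t1 <= t -> forall k, `|theta (idx k) t - 2 * pi * (z k)%:~R| <= a k.
Proof.
move=> t10 ab ini coh t t1t k.
pose u (kb : K * bool) s := (-1) ^+ kb.2 *
  (theta (idx kb.1) s - 2 * pi * (z kb.1)%:~R).
have ule s : (forall k, `|theta (idx k) s - 2 * pi * (z k)%:~R| <= a k) <->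
    (forall kb, u kb s <= a kb.1).
  split=> [H [k' b]|H k'].
    by apply: le_trans (H k'); rewrite -[leRHS](normrMsign b) ler_norm.
  have := H (k', true); have := H (k', false).
  by rewrite /u/= expr1 expr0 mul1r mulN1r ler_norml; lra.
move: k; apply/ule; move: t t1t.
apply: (@finite_trap _ _ u (fun kb s =>
  (-1) ^+ kb.2 * winfree_field (idx kb.1) (fun j => theta j s))).
- move=> [k b] s t1s; rewrite /u/=.
  apply: (@is_deriveZ _ _ _ (fun s => theta (idx k) s - 2 * pi * (z k)%:~R)
    ((-1) ^+ b) s 1).
  rewrite -[winfree_field _ _]subr0; apply: is_deriveB.
  by apply: solution_derive sol _ _ _; exact: le_trans t1s.
- exact/ule.
- move=> s t1s /ule us [k b] uE.
  by apply: barrier_inward (ab k) (coh s t1s us) _ uE.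
Qed.

(** If some term is at least [c / 2], at most [N - 1] terms are small and they add up to at most
    [(N - 1) * c / 2]. If none is, the total is too small. *)
Lemma sum_large_part (v : 'I_N -> R) (c : R) : 0 < c ->
  N%:R * c - c / 4 < \sum_i v i ->
  N%:R * (c / 2) + c / 4 < \sum_(i | c / 2 <= v i) v i.
Proof.
move=> c0 vc; have n1 : 1 <= N%:R :> R by rewrite ler1n.
have nc : c <= N%:R * c by rewrite ler_peMl// ltW.
have [[i0 vi0]|none] := pselect (exists i0, c / 2 <= v i0); last first.
  have : \sum_i v i <= \sum_(i < N) c / 2.
    apply: ler_sum => i _; rewrite leNgt; apply/negP => /ltW vi.
    by apply: none; exists i.
  by rewrite sumr_const card_ord -mulr_natl; lra.
have : \sum_i v i <= \sum_(i | c / 2 <= v i) v i +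
    \sum_i (c / 2 - if i == i0 then c / 2 else 0).
  rewrite [in leRHS]big_mkcond -big_split/=; apply: ler_sum => i _.
  have [vi|vi] := leP (c / 2) (v i).
    by rewrite lerDl; case: ifP => _; lra.
  rewrite add0r; have [ii0|_] := eqVneq i i0; last by lra.
  by move: vi; rewrite ii0 ltNge vi0.
rewrite sumrB sumr_const card_ord -mulr_natl -big_mkcond/= big_pred1_eq.
lra.
Qed.

Lemma coherence_persists t0 : 0 <= t0 ->
  Istar - Istar / (4 * N%:R) < order_param I theta t0 ->
  exists2 r, c3 * Istar / 2 < r & forall t, t0 <= t -> r <= order_param I theta t.
Proof.
move=> t00 Rt0.
have n0 : 0 < N%:R :> R by rewrite ltr0n.
have /choice[z zP] := fun i => reduce2pi (theta i t0).
pose y i := theta i t0 - 2 * pi * (z i)%:~R.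
have Iy i s : I (theta i s - 2 * pi * (z i)%:~R) = I (theta i s).
  by rewrite -mulrN -intrN periodic2pi_int.
pose a i := Num.max `|y i| alpha0.
have yle i : `|y i| <= a i by rewrite le_max lexx.
(* The bound of [sum_large_part], divided by [N] and multiplied by [c3]. *)
pose r : R := c3 * (Istar / 2 + Istar / (4 * N%:R)).
have rI : c3 * Istar / 2 < r.
  by rewrite /r -mulrA ltr_pM2l// ltrDl divr_gt0// mulr_gt0.
(* While the oscillators of large influence stay in their arcs, each keeps at least the fraction
   [c3] of its influence at time [t0]. *)
have Rge t : (forall i, Istar / 2 <= I (theta i t0) ->
    `|theta i t - 2 * pi * (z i)%:~R| <= a i) -> r <= order_param I theta t.
  move=> trapped.
  have H : N%:R * Istar - Istar / 4 < \sum_i I (theta i t0).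
    move: Rt0; rewrite /order_param ltr_pdivlMl//.
    have -> : N%:R * (Istar - Istar / (4 * N%:R)) = N%:R * Istar - Istar / 4 :> R.
      by field; rewrite gt_eqF.
    by [].
  have {}H := sum_large_part Istar0 H.
  rewrite /order_param ler_pdivlMl//.
  have -> : N%:R * r = c3 * (N%:R * (Istar / 2) + Istar / 4).
    by rewrite /r; field; rewrite gt_eqF.
  apply: (@le_trans _ _ (c3 * \sum_(i | Istar / 2 <= I (theta i t0)) I (theta i t0))).
    by rewrite ler_pM2l// ltW.
  rewrite mulr_sumr big_mkcond/=; apply: ler_sum => i _.
  case: ifP => [Ii|_]; last exact: I0.
  rewrite -(Iy i t0) -(Iy i t); apply: Ic3; first exact: zP.
  exact: trapped.
exists r => // t t0t; apply: (Rge) => i Ii.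
pose K := {i : 'I_N | Istar / 2 <= I (theta i t0)}.
(* An arc ends either at [alpha0] or where the bound on the influence is at least [Istar / 2]; each
   case uses one of the two lower bounds on [kappa]. *)
have ba (k : K) : barrier (a (val k)).
  rewrite /a; case: k => k /= Ik; have [_|ak] := leP `|y k| alpha0.
    exact: barrier_alpha0.
  apply: barrier_influence; first by rewrite ltW//= ler_norml; exact: zP.
  by apply: le_trans (Iq (zP k)); rewrite Iy.
apply: (winfree_trap (K := K) (idx := val) (z := z \o val) (a := a \o val) t00
  ba _ _ t0t (exist _ i Ii)).
  by move=> k; exact: yle.
move=> s t0s trapped; apply: (le_trans (ltW rI)); apply: Rge => j Ij.
exact: (trapped (exist _ j Ij)).
Qed.

(** Take [a = pi - X], where [c2] times the [q]-th power of [X] equals [Istar / 2]; if this is at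
    most [alpha0], then [alpha0] itself serves. *)
Lemma barrier_away_from_pi : exists2 a, 0 < a < pi & barrier a.
Proof.
have /andP[a00 a0pi] := a0.
have q0 : q != 0 by rewrite gt_eqF// (lt_le_trans ltr01 q1).
have Y0 : 0 < Istar / (2 * c2) by rewrite divr_gt0// mulr_gt0.
pose X : R := (Istar / (2 * c2)) `^ q^-1.
have X0 : 0 < X by exact: powR_gt0.
have [h|h] := leP (pi - X) alpha0.
  by exists alpha0 => //; exact: barrier_alpha0.
exists (pi - X); first by rewrite (lt_trans a00 h) gtrBl.
apply: barrier_influence; first by rewrite (ltW h) gerBl ltW.
rewrite opprB addrCA subrr addr0 /X -powRrM mulVf// powRr1 ?(ltW Y0)//.
by rewrite le_eqVlt; apply/orP; left; apply/eqP; field; rewrite gt_eqF.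
Qed.

Lemma solution_continuous i (s t : R) : 0 <= s ->
  {within `[s, t], continuous (theta i)}.
Proof.
move=> s0; apply: derivable_within_continuous => r.
rewrite in_itv/= => /andP[sr _].
by have [] := solution_derive sol i (le_trans s0 sr).
Qed.

(** Either the oscillator enters a translate of the arc [[- a, a]] and stays there, or by the
    intermediate value theorem it never leaves the gap between two neighbouring translates. The
    widths are [2 * a] and [2 * pi - 2 * a]. *)
Lemma coherent_oscillation (t0 r : R) i : 0 <= t0 -> c3 * Istar / 2 < r ->
  (forall t, t0 <= t -> r <= order_param I theta t) ->
  exists T lo hi : R, (forall t, T <= t -> lo <= theta i t <= hi) /\
    hi - lo < 2 * pi.
Proof.
move=> t00 rI Rr; have [a /andP[a00 api] ba] := barrier_away_from_pi.
have [[t1 [z [t01 tz]]]|out] := pselect (exists t1 (z : int), t0 <= t1 /\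
    `|theta i t1 - 2 * pi * z%:~R| <= a).
  exists t1, (2 * pi * z%:~R - a), (2 * pi * z%:~R + a); split; last by lra.
  move=> t t1t.
  have := winfree_trap (K := unit) (idx := fun=> i) (z := fun=> z)
    (a := fun=> a) (le_trans t00 t01) (fun=> ba) (fun=> tz) _ t1t tt.
  rewrite ler_norml => H; have /andP[] : - a <= theta i t - 2 * pi * z%:~R <= a.
    by apply: H => s t1s _; rewrite (le_trans (ltW rI))// Rr// (le_trans t01).
  lra.
have miss t (z : int) : t0 <= t -> a < `|theta i t - 2 * pi * z%:~R|.
  by move=> t0t; rewrite ltNge; apply/negP => H; apply: out; exists t, z.
(* The gap lies to the right or to the left of the multiple of [2 * pi] given by [reduce2pi],
   according to the sign of the difference. *)
have [z zP] : exists z : int,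
    2 * pi * z%:~R + a <= theta i t0 <= 2 * pi * (z + 1)%:~R - a.
  have [z /andP[z1 z2]] := reduce2pi (theta i t0).
  have := miss t0 z (lexx _); rewrite ltr_normr => /orP[H|H].
    by exists z; rewrite intrD; lra.
  by exists (z - 1); rewrite subrK intrB; lra.
exists t0, (2 * pi * z%:~R + a), (2 * pi * (z + 1)%:~R - a); split; last first.
  by rewrite intrD; lra.
have cross v t : t0 <= t -> Num.min (theta i t0) (theta i t) <= v <=
    Num.max (theta i t0) (theta i t) -> exists2 c, t0 <= c & theta i c = v.
  move=> t0t H; have [c] := IVT t0t (@solution_continuous i t0 t t00) H.
  by rewrite in_itv/= => /andP[t0c _] cv; exists c.
move=> t t0t; have /andP[z1 z2] := zP; apply/andP; split; rewrite leNgt; apply/negP => H.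
  have [|c t0c cE] := cross (2 * pi * z%:~R + a) t t0t.
    by rewrite ge_min le_max (ltW H) z1 orbT.
  have := miss c z t0c; rewrite cE addrC addKr gtr0_norm ?ltxx//.
have [|c t0c cE] := cross (2 * pi * (z + 1)%:~R - a) t t0t.
  by rewrite ge_min le_max (ltW H) z2 orbT.
have := miss c (z + 1) t0c; rewrite cE addrC addKr normrN gtr0_norm ?ltxx//.
Qed.

Lemma oscillator_death : ~ incoherent theta0 ->
  ((c3 * Istar / 2)%:E < liminf_infty (order_param I theta))%E /\
  (forall i, exists ls li : R,
     limsup_infty (theta i) = ls%:E /\ liminf_infty (theta i) = li%:E /\
     ls - li < 2 * pi).
Proof.
move=> coherent.
have [t0 t00 Rt0] : exists2 t0, 0 <= t0 &
    Istar - Istar / (4 * N%:R) < order_param I theta t0.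
  apply: contrapT => H; apply: coherent; exists theta; split=> // t t0.
  by rewrite leNgt; apply/negP => Rt; apply: H; exists t.
have [r rI Rr] := coherence_persists t00 Rt0; split.
  by apply: lt_le_trans (liminf_infty_ge Rr); rewrite lte_fin.
move=> i; have [T [lo [hi [lohi w]]]] := coherent_oscillation i t00 rI Rr.
have [ls [li [-> [-> lsli]]]] := eventual_oscillation lohi.
by exists ls, li; do 2!split=> //; exact: le_lt_trans w.
Qed.

End Winfree.
Unset Implicit Arguments. Set Strict Implicit. Set Printing Implicit Defensive.

Theorem theorem2p14 (R : realType) (S I : R -> R)
  (alpha0 p q c1 c2 c3 c4 Istar : R) (N : nat) (omega : 'I_N -> R) (kappa : R) :
  periodic2pi S -> periodic2pi I ->
  lipschitzR S -> lipschitzR I ->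
  (forall x, derivable S x 1) -> (forall x, derivable I x 1) ->
  0 < alpha0 < pi ->
  1 <= p -> 1 <= q -> 0 < c1 -> 0 < c2 -> 0 < c3 <= 1 -> 0 < c4 -> 0 < Istar ->
  (forall th, alpha0 <= th <= pi -> S th <= - (c1 * (pi - th) `^ p)) ->
  (forall th, - pi <= th <= - alpha0 -> c1 * (th + pi) `^ p <= S th) ->
  (forall th, - pi <= th <= pi -> 0 <= I th /\ I th <= c2 * (pi - `|th|) `^ q) ->
  (forall th, - pi <= th <= pi ->
     forall ph, `|ph| <= Num.max `|th| alpha0 -> c3 * I th <= I ph) ->
  (forall th, c4 * (Istar - I th) <= derive1 S th) ->
  (forall th, 0 <= derive1 I th * S th) ->
  (forall th, - pi < th < pi -> 0 < I th) ->
  (0 < N)%N ->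
  Num.max
    (2 * (2 * c2) `^ (p / q) / (c1 * c3) * (supnorm omega / Istar `^ (1 + p / q)))
    (2 / (c1 * c3 * (pi - alpha0) `^ p) * (supnorm omega / Istar))
    < kappa ->
  exists E : set ('I_N -> R), lebesgue_nullN E /\
    forall theta0 : 'I_N -> R, ~ E theta0 ->
    forall theta : 'I_N -> R -> R, is_solution S I omega kappa theta0 theta ->
      ((c3 * Istar / 2)%:E < liminf_infty (order_param I theta))%E /\
      (forall i, exists ls li : R,
          limsup_infty (theta i) = ls%:E /\ liminf_infty (theta i) = li%:E /\
          ls - li < 2 * pi).
Proof.
move=> SP IP SL IL Sd Id a0 p1 q1 c10 c20 /andP[c30 c31] c40 Istar0.
move=> Sright Sleft Iq Ic3 SI IS Ipos N0; rewrite gt_max => /andP[kappa1 kappa2].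
have I0 x : 0 <= I x.
  have [z xz] := reduce2pi x.
  have -> : I x = I (x - 2 * pi * z%:~R).
    by rewrite -mulrN -intrN periodic2pi_int.
  exact: (Iq _ xz).1.
(* The first term of the maximum is nonnegative. *)
have kappa0 : 0 < kappa.
  apply: le_lt_trans kappa1; rewrite mulr_ge0// divr_ge0 ?powR_ge0//.
  - by rewrite mulr_ge0 ?powR_ge0.
  - by rewrite mulr_ge0// ltW.
  - by apply: bigmax_ge_id.
exists (incoherent S I omega kappa Istar); split.
  by apply: (lebesgue_nullN_incoherent SP IP omega SL IL Sd Id N0 kappa0 c40).
move=> theta0 coherent theta sol.
have Iq2 th : - pi <= th <= pi -> I th <= c2 * (pi - `|th|) `^ q.
  by move=> /Iq[].
exact: (oscillator_death SP IP N0 kappa0 I0 Istar0 a0 p1 q1 c10 c20 c30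
  Sright Sleft Iq2 Ic3 kappa1 kappa2 sol coherent).
Qed.
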